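(* There exists an algorithm that, given a DFA $\mathcal{A}=(Q,\Sigma)$, decides the winner in the $\omega$-game on $\mathcal{A}$ in $O(|Q|^2\cdot|\Sigma|)$ time.
   Context: A DFA $\mathcal{A}=(Q,\Sigma)$ consists of finite nonempty sets $Q$ (states) and $\Sigma$ (letters) with a map $Q\times\Sigma\to Q$, $(q,a)\mapsto q\cdot a$, extended to words by $q\cdot\varepsilon=q$, $q\cdot(wa)=(q\cdot w)\cdot a$, and to subsets by $P\cdot w=\{p\cdot w:p\in P\}$. All DFAs considered have at least three states. A word $w$ is a reset word for $\mathcal{A}$ if $|Q\cdot w|=1$. The $\omega$-game on $\mathcal{A}$: two players, Alice and Bob, alternate moves. On each of her turns Alice chooses a letter of $\Sigma$; on each of his turns Bob chooses an arbitrary finite word in $\Sigma^*$ (possibly empty). The history of the game up to a turn is the concatenation, in order, of all letters and words chosen so far. Alice wins if at some turn the history is a reset word for $\mathcal{A}$; Bob wins if the game continues forever. (It does not matter who moves first.) Deciding the winner means deciding which player has a winning strategy. The DFA is given by its transition table, and time is measured in the usual unit-cost random-access model. *)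

(* Defs.v *)
From mathcomp Require Import all_boot.
Set Implicit Arguments.
Unset Strict Implicit.
Unset Printing Implicit Defensive.

Definition dfa (Q S : finType) := Q -> S -> Q.

Definition act (Q S : finType) (A : dfa Q S) (q : Q) (w : seq S) : Q :=
  foldl A q w.

Definition act_set (Q S : finType) (A : dfa Q S) (P : {set Q}) (w : seq S)
  : {set Q} := [set act A p w | p in P].

Definition reset_word (Q S : finType) (A : dfa Q S) (w : seq S) : bool :=
  #|act_set A [set: Q] w| == 1.

Inductive player := Alice | Bob.

Definition opponent (p : player) : player :=
  if p is Alice then Bob else Alice.

Definition mover (first : player) (t : nat) : player :=
  if odd t then opponent first else first.

(* A strategy sees the full list of moves made so far; a letter chosen by
   Alice is recorded there as a one-letter word. *)
Definition alice_strategy (S : finType) := seq (seq S) -> S.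
Definition bob_strategy (S : finType) := seq (seq S) -> seq S.

Fixpoint play (S : finType) (first : player) (sigma : alice_strategy S)
    (tau : bob_strategy S) (t : nat) : seq (seq S) :=
  if t is t'.+1 then
    let moves := play first sigma tau t' in
    rcons moves (if mover first t' is Alice then [:: sigma moves]
                 else tau moves)
  else [::].

Definition history (S : finType) (first : player) (sigma : alice_strategy S)
    (tau : bob_strategy S) (t : nat) : seq S :=
  flatten (play first sigma tau t).

(* Play formally goes on after Alice has won; this is harmless, since every
   extension of a reset word is a reset word. *)
Definition alice_wins_play (Q S : finType) (A : dfa Q S) (first : player)
    (sigma : alice_strategy S) (tau : bob_strategy S) : Prop :=
  exists t, reset_word A (history first sigma tau t).

Definition has_winning_strategy (Q S : finType) (A : dfa Q S)
    (first p : player) : Prop :=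
  match p with
  | Alice => exists sigma, forall tau, alice_wins_play A first sigma tau
  | Bob => exists tau, forall sigma, ~ alice_wins_play A first sigma tau
  end.

(* Registers are named directly by the program, so each program uses only
   finitely many of them; memory cells are addressed through registers.
   Arithmetic is restricted to addition and truncated subtraction:
   unit-cost multiplication would only make a time bound weaker. *)
Inductive instr :=
  | Const of nat & nat
  | Move of nat & nat
  | Add of nat & nat & nat
  | Sub of nat & nat & nat
  | Read of nat & nat
  | Write of nat & nat
  | Jump of nat
  | JumpZ of nat & nat
  | Halt.

Definition program := seq instr.

Record config := Config { pc : nat; regs : nat -> nat; mem : nat -> nat }.

(* A program counter outside the program reads as [Halt]. *)
Definition current (P : program) (c : config) : instr := nth Halt P (pc c).

Definition halted (P : program) (c : config) : bool :=
  if current P c is Halt then true else false.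

Definition step (P : program) (c : config) : config :=
  let: Config l R M := c in
  match current P c with
  | Const i k => Config l.+1 [eta R with i |-> k] M
  | Move i j => Config l.+1 [eta R with i |-> R j] M
  | Add i j k => Config l.+1 [eta R with i |-> R j + R k] M
  | Sub i j k => Config l.+1 [eta R with i |-> R j - R k] M
  | Read i j => Config l.+1 [eta R with i |-> M (R j)] M
  | Write i j => Config l.+1 R [eta M with R i |-> R j]
  | Jump l' => Config l' R M
  | JumpZ i l' => Config (if R i == 0 then l' else l.+1) R M
  | Halt => c
  end.

(* The input occupies an initial segment of the memory; all other cells and
   all registers start at 0. *)
Definition init (input : seq nat) : config :=
  Config 0 (fun=> 0) (nth 0 input).


Definition outputs_within (P : program) (input : seq nat) (t out : nat)
  : Prop :=
  exists k, let c := iter k (step P) (init input) in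
    [/\ k <= t, halted P c & regs c 0 = out].

(* |Q|, |S|, then the transition table in row-major order, states being
   named by their position in [enum Q]. *)
Definition encode_dfa (Q S : finType) (A : dfa Q S) : seq nat :=
  [:: #|Q|, #|S| & [seq index (A q a) (enum Q) | q <- enum Q, a <- enum S]].

Definition encode_player (p : player) : nat := if p is Alice then 1 else 0.

(* Main.v *)
Require Import Defs.
From mathcomp Require Import all_boot zify.
Set Implicit Arguments.
Unset Strict Implicit.
Unset Printing Implicit Defensive.

(** In the graph of pairs of states, Bob wins as soon as some pair x of distinct
states can be reached back from every x.a: he restores x after each letter.
Otherwise Alice always applies a letter after which an unmerged pair can no
longer be restored; the total number of unmerged pairs reachable from the
images of all pairs then drops at each of her moves.

The algorithm is one depth-first search of the pair graph, with the diagonal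
finished in advance, that maintains strongly connected components as Tarjan's
algorithm does and flags a vertex when an edge from it into a finished
component is seen.  Bob wins iff some vertex has no edge left but no flag.
A visited vertex is unfinished iff the cell of the component stack at its
recorded position still contains it; hence a whole component is finished in
constant time, by lowering the stack pointer, and every iteration of the
search takes constant time. *)

(** * The game on pairs of states *)

Definition pair_act (Q S : finType) (A : dfa Q S) (x : Q * Q) (w : seq S) :=
  (act A x.1 w, act A x.2 w).

Definition pair_edge (Q S : finType) (A : dfa Q S) : rel (Q * Q) :=
  fun x y => [exists a, y == pair_act A x [:: a]].

Definition escapable (Q S : finType) (A : dfa Q S) (x : Q * Q) :=
  [exists a, ~~ connect (pair_edge A) (pair_act A x [:: a]) x].

Section Game.
Variables (Q S : finType) (A : dfa Q S).
Implicit Types (x y : Q * Q) (w u : seq S) (first : player).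

Lemma pair_act_cat x w u :
  pair_act A x (w ++ u) = pair_act A (pair_act A x w) u.
Proof. by rewrite /pair_act /act !foldl_cat. Qed.

Lemma connect_pair_act x w : connect (pair_edge A) x (pair_act A x w).
Proof.
elim: w x => [|a w IHw] x; first by case: x => p q; apply: connect0.
rewrite -cat1s pair_act_cat; apply: connect_trans (IHw _).
by apply: connect1; apply/existsP; exists a.
Qed.

Lemma connect_wordP x y :
  reflect (exists w, pair_act A x w == y) (connect (pair_edge A) x y).
Proof.
apply: (iffP idP) => [/connectP[s]|[w /eqP<-]]; last exact: connect_pair_act.
elim: s x => [|z s IHs] x /= => [_ ->|/andP[/existsP[a /eqP->]] sz ys].
  by exists [::]; case: x.
by have [w /eqP<-] := IHs _ sz ys; exists (a :: w); rewrite -cat1s pair_act_cat.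
Qed.

(** A strategy must be a function, so the return word is extracted by [xchoose] from a reachability
    proof obtained by matching on [idP]; unreachable targets get the empty word. *)
Definition word_to x y : seq S :=
  if @idP (connect (pair_edge A) x y) is ReflectT c
  then xchoose (connect_wordP x y c) else [::].

Lemma word_toP x y :
  connect (pair_edge A) x y -> pair_act A x (word_to x y) = y.
Proof.
by rewrite /word_to; case: {-}_ / idP => // c _; apply/eqP/(xchooseP (connect_wordP x y c)).
Qed.

(** A word acts on both components alike, so merged states stay merged: after a reset, an
    off-diagonal pair is lost for good. *)
Lemma diag_connect x y :
  connect (pair_edge A) x y -> x.1 = x.2 -> y.1 = y.2.
Proof. by case/connect_wordP=> w /eqP<- /= ->. Qed.

Lemma reset_wordP w : 0 < #|Q| ->
  reflect (forall x, act A x.1 w = act A x.2 w) (reset_word A w).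
Proof.
move=> Q0; apply: (iffP cards1P) => [[r Er] [p q] /=|merge].
  have in_r z : act A z w = r by apply/set1P; rewrite -Er imset_f ?inE.
  by rewrite !in_r.
have /card_gt0P[p _] := Q0; exists (act A p w); apply/setP=> r; rewrite inE.
apply/imsetP/eqP=> [[q _ ->]|->]; first exact: (merge (q, p)).
by exists p.
Qed.

Lemma history_rec first (sigma : alice_strategy S) (tau : bob_strategy S) t :
  history first sigma tau t.+1 = history first sigma tau t ++
    (if mover first t is Alice then [:: sigma (play first sigma tau t)]
     else tau (play first sigma tau t)).
Proof. by rewrite /history /= flatten_rcons. Qed.

Lemma mover_next first t : mover first t.+1 = opponent (mover first t).
Proof. by rewrite /mover /=; case: odd; case: first. Qed.

(* Bob brings the inescapable pair back to itself after every letter. *)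
Lemma bob_wins x first : 0 < #|Q| -> x.1 != x.2 -> ~~ escapable A x ->
  has_winning_strategy A first Bob.
Proof.
move=> Q0 offx trapx.
exists (fun moves => word_to (pair_act A x (flatten moves)) x) => sigma.
set tau := (fun moves : seq (seq S) => _) => -[t].
pose xt t := pair_act A x (history first sigma tau t).
(* Bob can always return to [x], and the pair is exactly [x] when Alice moves. A reset would put it
   on the diagonal, from where [x] is unreachable. *)
suff [/diag_connect back _]: connect (pair_edge A) (xt t) x /\
    (mover first t = Alice -> xt t = x).
  by move=> /reset_wordP-/(_ Q0 x) /back /eqP; rewrite (negPf offx).
elim: t => [|t [IH1 IH2]].
  by rewrite /xt /history /pair_act /=; case: (x).
rewrite /xt history_rec; case Em: (mover first t).
  split; last by rewrite mover_next Em.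
  rewrite pair_act_cat -/(xt t) (IH2 Em); move: trapx.
  by move=> /existsPn/(_ (sigma (play first sigma tau t)))/negPn.
have -> : pair_act A x (history first sigma tau t ++ tau (play first sigma tau t))
  = x by rewrite pair_act_cat word_toP.
by split.
Qed.

Definition pair_potential y : nat :=
  #|[set z | connect (pair_edge A) y z & z.1 != z.2]|.

Definition potential w : nat := \sum_x pair_potential (pair_act A x w).

Lemma pair_potential_act y w : pair_potential (pair_act A y w) <= pair_potential y.
Proof.
apply: subset_leq_card; apply/subsetP=> z; rewrite !inE => /andP[yz ->].
by rewrite (connect_trans (connect_pair_act y w) yz).
Qed.

(** [y] itself is counted before the letter and not after it, while nothing new becomes
    reachable. *)
Lemma pair_potential_lt y a : y.1 != y.2 ->
  ~~ connect (pair_edge A) (pair_act A y [:: a]) y ->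
  pair_potential (pair_act A y [:: a]) < pair_potential y.
Proof.
move=> offy noy; apply: proper_card; apply/properP; split.
  apply/subsetP=> z; rewrite !inE => /andP[yz ->].
  by rewrite (connect_trans (connect_pair_act y [:: a]) yz).
by exists y; rewrite !inE ?connect0 // negb_and noy.
Qed.

Lemma potential_cat w u : potential (w ++ u) <= potential w.
Proof. by apply: leq_sum => x _; rewrite pair_act_cat pair_potential_act. Qed.

Lemma potential_lt w x a : act A x.1 w != act A x.2 w ->
  ~~ connect (pair_edge A) (pair_act A (pair_act A x w) [:: a]) (pair_act A x w) ->
  potential (w ++ [:: a]) < potential w.
Proof.
move=> offx esc; rewrite /potential (bigD1 x) //= [X in _ < X](bigD1 x) //=.
rewrite -addSn leq_add //.
  by rewrite pair_act_cat pair_potential_lt.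
by apply: leq_sum => y _; rewrite pair_act_cat pair_potential_act.
Qed.

Lemma alice_wins first : 0 < #|Q| -> 0 < #|S| ->
  (forall x, x.1 != x.2 -> escapable A x) -> has_winning_strategy A first Alice.
Proof.
move=> Q0 /card_gt0P[a0 _] esc.
(* The sigma type turns the choice of a letter into a strategy; once all pairs are merged, [a0]
   serves as a default. *)
have letterP w : {a | reset_word A w \/ potential (w ++ [:: a]) < potential w}.
  case: (pickP (fun x : Q * Q => act A x.1 w != act A x.2 w)) => [x offx|merge].
    have /existsP/sigW[a lta] := esc (pair_act A x w) offx.
    by exists a; right; apply: potential_lt offx lta.
  by exists a0; left; apply/reset_wordP => // x; have /negbFE/eqP := merge x.
exists (fun moves => sval (letterP (flatten moves))) => tau.
set sigma := (fun moves : seq (seq S) => _).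
pose h := history first sigma tau.
have dec t : potential (h t.+1) <= potential (h t).
  by rewrite /h history_rec potential_cat.
have decA t : mover first t = Alice ->
    reset_word A (h t) \/ potential (h t.+1) < potential (h t).
  move=> Em; rewrite /h history_rec Em /sigma.
  by case: (letterP _).
(* Two consecutive turns contain one move of Alice, so without a reset [k] rounds cost [k] units of
   potential; one round more than the initial potential is impossible. *)
suff /(_ (potential (h 0)).+1)[//|]: forall k,
    (exists t, reset_word A (h t)) \/ potential (h k.*2) + k <= potential (h 0).
  by rewrite addnS ltnNge leq_addl.
elim=> [|k [IH|IH]]; [by right; rewrite addn0 | by left | ].
have [Em|Em]: mover first k.*2 = Alice \/ mover first k.*2.+1 = Alice.
- by rewrite mover_next; case: (mover first _); auto.
- have [r|lt] := decA _ Em; first by left; exists k.*2.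
  right; apply: leq_trans IH; rewrite doubleS addnS -addSn leq_add2r.
  exact: leq_ltn_trans (dec _) lt.
have [r|lt] := decA _ Em; first by left; exists k.*2.+1.
right; apply: leq_trans IH; rewrite doubleS addnS -addSn leq_add2r.
exact: leq_trans lt (dec _).
Qed.

End Game.

(** * Depth-first search *)

Section DFS.
Variables (V : finType) (m : nat) (succ : V -> nat -> V) (D : pred V).

Definition sedge : rel V := fun x y => [exists a : 'I_m, y == succ x a].
Notation reaches := (connect sedge).

(** [grey] is the search path, top first; [scc] is the component stack, bottom first, so that
    positions survive pushes. [nxt] counts explored edges, and [low] stores a position in [scc]. *)
Record state := State {
  grey : seq V; scc : seq V; vis : V -> bool;
  nxt : V -> nat; low : V -> nat; flag : V -> bool }.

Definition update (T : Type) (f : V -> T) x t := fun y => if y == x then t else f y.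

Definition pos s x := index x (scc s).

Definition done s x := vis s x && (x \notin scc s).

Definition visit s x := State (x :: grey s) (rcons (scc s) x)
  (update (vis s) x true) (nxt s) (update (low s) x (size (scc s))) (flag s).

Definition advance s v := let w := succ v (nxt s v) in
  if w \in scc s then
    State (grey s) (scc s) (vis s) (update (nxt s) v (nxt s v).+1)
      (update (low s) v (minn (low s v) (pos s w))) (flag s)
  else
    State (grey s) (scc s) (vis s) (update (nxt s) v (nxt s v).+1)
      (low s) (update (flag s) v true).

Definition close s v := State (behead (grey s)) (take (pos s v) (scc s))
  (vis s) (nxt s) (low s) (flag s).

Definition retreat s v u := State (behead (grey s)) (scc s)
  (vis s) (nxt s) (update (low s) u (minn (low s u) (low s v))) (flag s).

Definition escapes x := exists2 a, a < m & ~~ reaches (succ x a) x.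

(** [k] is the position of the grey vertex above [g], or the stack height. All stacked vertices
    below [k], including those below [v], reach [v]; the empty case puts the lowest grey vertex at
    the bottom of the stack. *)
Fixpoint stack_ok s k g : Prop :=
  if g is v :: g' then
    [/\ v \in scc s, pos s v < k,
      (forall y, y \in scc s -> pos s y < k -> reaches y v) &
      stack_ok s (pos s v) g']
  else forall y, y \in scc s -> pos s y < k -> False.

(* An explored edge between two vertices on the component stack never jumps
   upwards over a grey vertex, and when it jumps downwards over one, this is
   recorded by [low]. *)
Definition edge_ok s x w :=
  forall g, g \in grey s ->
    (pos s x < pos s g -> pos s w < pos s g) /\
    (pos s g <= pos s x -> pos s w < pos s g ->
      exists2 g', g' \in grey s &
        [/\ pos s g <= pos s g', pos s g' <= pos s x & low s g' <= pos s w]).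

(** [inv_flag] and [inv_low] state that the recorded data are sound, [inv_edge] that they cover all
    explored edges. By [inv_fin] a vertex leaves the path only when flagged, which makes every
    vertex of a closed component escape. *)
Record inv s : Prop := Inv {
  inv_uniq : uniq (scc s);
  inv_vis x : x \in scc s -> vis s x;
  inv_D x : D x -> done s x;
  inv_closed x a : done s x -> a < m -> done s (succ x a);
  inv_esc x : done s x -> ~~ D x -> escapes x;
  inv_edge x a : x \in scc s -> a < m -> a < nxt s x ->
    let w := succ x a in
    done s w /\ flag s x \/ w \in scc s /\ edge_ok s x w;
  inv_flag x : x \in scc s -> flag s x -> exists2 a, a < m & done s (succ x a);
  inv_fin x : x \in scc s -> x \notin grey s -> (m <= nxt s x) && flag s x;
  inv_stack : stack_ok s (size (scc s)) (grey s);
  inv_low g : g \in grey s -> low s g <= pos s g /\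
    exists w, [/\ w \in scc s, pos s w = low s g & reaches g w];
  inv_white x : ~~ vis s x -> nxt s x = 0 /\ flag s x = false }.

(** * Preservation of the search invariant *)

Lemma reaches_succ x a : a < m -> reaches x (succ x a).
Proof. by move=> lt; apply/connect1/existsP; exists (Ordinal lt). Qed.

Lemma stack_ok_sub s k g x : stack_ok s k g -> x \in g ->
  (x \in scc s) && (pos s x < k).
Proof.
elim: g k => // v g IHg k [vS vk _ /IHg okg]; rewrite inE => /predU1P[->|/okg].
  by rewrite vS vk.
by case/andP=> -> /ltn_trans->.
Qed.

Lemma stack_uniq s k g : stack_ok s k g -> uniq g.
Proof.
elim: g k => //= v g IHg k [_ _ _ okg]; rewrite (IHg _ okg) andbT.
by apply/negP=> /(stack_ok_sub okg)/andP[_]; rewrite ltnn.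
Qed.

Lemma grey_scc s x : inv s -> x \in grey s -> x \in scc s.
Proof. by move=> I /(stack_ok_sub (inv_stack I))/andP[]. Qed.

(** Only positions below [k] matter, so the property survives pushes above [k] and truncation at
    [k]. *)
Lemma stack_ok_eq s s' k g :
  (forall y, (y \in scc s') && (pos s' y < k) =
             (y \in scc s) && (pos s y < k)) ->
  (forall y, y \in scc s -> pos s y < k -> pos s' y = pos s y) ->
  stack_ok s k g -> stack_ok s' k g.
Proof.
elim: g k => [|v g IHg] k E1 E2 /=.
  by move=> H y yS yk; have := E1 y; rewrite yS yk => /esym/andP[]; apply: H.
case=> vS vk H okg.
have /andP[vS' vk'] : (v \in scc s') && (pos s' v < k) by rewrite E1 vS.
have Ev := E2 _ vS vk; split=> // [y yS yk|].
  by have := E1 y; rewrite yS yk => /esym/andP[]; apply: H.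
rewrite Ev; apply: IHg okg => y.
  have := E1 y.
  case: (boolP ((y \in scc s) && (pos s y < k))) => [/andP[yS yk] /andP[yS' _]|no E].
    by rewrite yS yS' E2.
  transitivity false; last apply/esym; apply/negbTE.
    by apply: contraFN E => /andP[-> lt]; apply: ltn_trans lt vk.
  by apply: contra no => /andP[-> lt]; apply: ltn_trans lt vk.
by move=> yS yv; apply: E2 => //; apply: ltn_trans vk.
Qed.

(** The new vertex enters above the whole stack, leaving old positions and edges unaffected. All
    stacked vertices reach it through the old top; if nothing is grey, the stack is empty. *)
Lemma visit_inv s x : inv s -> ~~ vis s x ->
  (if grey s is v :: _ then reaches v x else True) -> inv (visit s x).
Proof.
move=> I whx topx; have [? Iv ID Ic Ie Iedge Ifl Ifin Ist Il Iw] := I.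
have xS : x \notin scc s by apply: contra whx; apply: Iv.
have Ed y : done (visit s x) y = done s y.
  rewrite /done /= /update mem_rcons inE; case: eqP => //= ->.
  by rewrite (negPf whx).
have Ep y : y \in scc s -> pos (visit s x) y = pos s y.
  by move=> yS; rewrite /pos /= -cats1 index_cat yS.
have Ex : pos (visit s x) x = size (scc s).
  by rewrite /pos /= -cats1 index_cat (negPf xS) /= eqxx addn0.
have lt_pos y : y \in scc s -> pos s y < size (scc s) by rewrite /pos index_mem.
have El y : y \in scc s -> low (visit s x) y = low s y.
  by rewrite /= /update; case: eqP => // ->; rewrite (negPf xS).
have nx : nxt s x = 0 /\ flag s x = false by apply: Iw.
split; rewrite /= ?rcons_uniq ?xS //.
- by move=> y; rewrite mem_rcons inE /update; case: eqP => //= _; apply: Iv.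
- by move=> y; rewrite Ed; apply: ID.
- by move=> y a; rewrite !Ed; apply: Ic.
- by move=> y; rewrite Ed; apply: Ie.
- move=> y a; rewrite mem_rcons inE => /predU1P[->|yS lta ltn]; first by rewrite nx.1.
  have [[dw fy]|[wS ok]] := Iedge _ _ yS lta ltn; [left|right].
    by rewrite Ed.
  rewrite mem_rcons inE wS orbT; split=> // g; rewrite inE.
  move=> /predU1P[->|gg]; rewrite !(Ep y) // !(Ep (succ y a)) //.
    by rewrite Ex; split=> [_|]; [apply: lt_pos | rewrite leqNgt lt_pos].
  have gS := grey_scc I gg; rewrite !(Ep g) //; have [ok1 ok2] := ok _ gg.
  split=> // /ok2 H /H[g' gg' [l1 l2 l3]]; have gS' := grey_scc I gg'.
  by exists g'; rewrite ?inE ?gg' ?orbT // !Ep ?(El g').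
- move=> y; rewrite mem_rcons inE => /predU1P[->|yS /(Ifl _ yS)[a lta da]].
    by rewrite nx.2.
  by exists a; rewrite ?Ed.
- move=> y; rewrite mem_rcons !inE negb_or => /predU1P[->|yS]; first by rewrite eqxx.
  by move/andP=> [_]; apply: Ifin.
- split; rewrite ?mem_rcons ?mem_head ?Ex ?size_rcons //.
    move=> y; rewrite mem_rcons inE => /predU1P[-> _|yS _]; first exact: connect0.
    have := Ist; case: (grey s) topx => [|v g] topx /=.
      by move=> /(_ y yS (lt_pos _ yS)).
    case=> _ _ H _; exact: connect_trans (H _ yS (lt_pos _ yS)) topx.
  apply: stack_ok_eq Ist => [y|y yS _]; last exact: Ep.
  rewrite mem_rcons inE; case: (boolP (y \in scc s)) => yS.
    by rewrite orbT Ep.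
  case: eqP => //= ->; by rewrite Ex ltnn.
- move=> g; rewrite inE => /predU1P[->|gg].
    rewrite Ex /update eqxx; split=> //; exists x.
    by rewrite mem_rcons mem_head Ex connect0.
  have gS := grey_scc I gg; rewrite Ep //; move: (El g gS) => /= ->.
  have [l [w [wS Ew gw]]] := Il _ gg; split=> //; exists w.
  by rewrite mem_rcons inE wS orbT Ep.
- by move=> y; rewrite /update; case: eqP => //= _; apply: Iw.
Qed.

Lemma grey_top s v g x : inv s -> grey s = v :: g -> x \in g -> pos s x < pos s v.
Proof.
move=> I Eg xg; have := inv_stack I; rewrite Eg => -[_ _ _ okg].
by have /andP[] := stack_ok_sub okg xg.
Qed.

Lemma grey_le s v g x : inv s -> grey s = v :: g -> x \in grey s ->
  pos s x <= pos s v.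
Proof.
move=> I Eg; rewrite Eg inE => /predU1P[->//|xg].
exact: ltnW (grey_top I Eg xg).
Qed.

Lemma advance_inv s v g : inv s -> grey s = v :: g -> nxt s v < m ->
  vis s (succ v (nxt s v)) -> inv (advance s v).
Proof.
move=> I Eg ltm visw; have [U Iv ID Ic Ie Iedge Ifl Ifin Ist Il Iw] := I.
have vg : v \in grey s by rewrite Eg mem_head.
have vS := grey_scc I vg.
set w := succ v (nxt s v) in visw *.
rewrite /advance -/w; case: ifP => wS.
  have lowle y : update (low s) v (minn (low s v) (pos s w)) y <= low s y.
    by rewrite /update; case: eqP => // ->; rewrite geq_minl.
  have le_ok x y : edge_ok s x y -> edge_ok (State (grey s) (scc s) (vis s)
      (update (nxt s) v (nxt s v).+1)
      (update (low s) v (minn (low s v) (pos s w))) (flag s)) x y.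
    move=> ok h hg; have [ok1 ok2] := ok h hg; split=> //.
    move=> /ok2 H /H[h' hg' [l1 l2 l3]]; exists h' => //; split=> //.
    exact: leq_trans (lowle _) l3.
  split=> //=.
  - move=> x a xS lta; rewrite {1}/update.
    case: eqP => [->|_ ltn]; last first.
      have [?|[? /le_ok ?]] := Iedge _ _ xS lta ltn; first by left.
      by right.
    rewrite ltnS leq_eqVlt => /predU1P[->|ltn]; last first.
      have [?|[? /le_ok ?]] := Iedge _ _ vS lta ltn; first by left.
      by right.
    (* [v] is the topmost grey vertex, so its position is below no grey one; a downward jump from it
       is recorded by its own [low]. *)
    right; split=> // h hg; rewrite /pos /= -!/(pos _ _); split.
      by rewrite ltnNge (grey_le I Eg hg).
    move=> hv wh; exists v => //; split=> //=.
    by rewrite /update eqxx geq_minr.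
  - move=> x xS; rewrite /update; case: eqP => [->|_]; first by rewrite vg.
    exact: Ifin.
  - exact: stack_ok_eq Ist.
  - move=> h hg; have [l1 l2] := Il h hg.
    split; first exact: leq_trans (lowle h) l1.
    rewrite /update; case: eqP => [Eh|//]; rewrite Eh in l2.
    rewrite /minn; case: ifP => _; first by rewrite Eh; have [z] := l2; exists z.
    by exists w; split=> //; rewrite Eh reaches_succ.
  - move=> x whx; rewrite /update; case: eqP => [Ex|_]; last exact: Iw.
    by rewrite Ex Iv in whx.
(* A visited vertex off the component stack is finished, so this edge justifies the flag. *)
have dw : done s w by rewrite /done visw wS.
have flagge y : flag s y -> update (flag s) v true y.
  by rewrite /update; case: eqP.
split=> //=.
- move=> x a xS lta; rewrite {1}/update.
  case: eqP => [->|nxv ltn]; last first.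
    have [[dy fy]|?] := Iedge _ _ xS lta ltn; last by right.
    by left; rewrite flagge.
  rewrite ltnS leq_eqVlt => /predU1P[->|ltn]; last first.
    have [[dy fy]|?] := Iedge _ _ vS lta ltn; last by right.
    by left; rewrite flagge.
  by left; rewrite /update eqxx.
- move=> x xS; rewrite /update; case: eqP => [-> _|_]; last exact: Ifl.
  by exists (nxt s v).
- move=> x xS xg; have /andP[le fx] := Ifin _ xS xg.
  rewrite (flagge _ fx) andbT /update; case: eqP => [Ex|//].
  by rewrite Ex vg in xg.
- exact: stack_ok_eq Ist.
- move=> x whx; rewrite /update; case: eqP => [Ex|_]; last exact: Iw.
  by rewrite Ex Iv in whx.
Qed.

(* The part of the component stack above [v] is closed under the unfinished
   edges, so that adding it to the finished vertices keeps them closed. *)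
Lemma close_inv s v g : inv s -> grey s = v :: g -> m <= nxt s v -> flag s v ->
  pos s v <= low s v -> inv (close s v).
Proof.
move=> I Eg lem flv lowv; have [U Iv ID Ic Ie Iedge Ifl Ifin Ist Il Iw] := I.
have vg : v \in grey s by rewrite Eg mem_head.
have vS := grey_scc I vg.
have memS y : (y \in scc (close s v)) = (y \in scc s) && (pos s y < pos s v).
  rewrite /= in_take_leq ?index_size //.
  case: (boolP (y \in scc s)) => //= yS; apply/negbTE; rewrite -leqNgt.
  by rewrite /pos (memNindex yS) index_size.
have Ep y : y \in scc (close s v) -> pos (close s v) y = pos s y.
  move=> yS; rewrite {2}/pos -[in RHS](cat_take_drop (pos s v) (scc s)) index_cat.
  by rewrite /= in yS; rewrite yS.
have Ed y : done (close s v) y = done s y || (y \in scc s) && (pos s v <= pos s y).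
  rewrite /done memS /=; case: (boolP (y \in scc s)) => yS /=.
    by rewrite Iv //= -leqNgt.
  by rewrite orbF.
(* No other vertex above [v] is grey, so everything from [v] upwards is fully explored and
   flagged. *)
have fin x : x \in scc s -> pos s v <= pos s x -> (m <= nxt s x) && flag s x.
  move=> xS lvx; case: (boolP (x \in grey s)) => [|/(Ifin _ xS)//].
  rewrite Eg inE => /predU1P[->|/(grey_top I Eg)]; first by rewrite lem.
  by rewrite ltnNge lvx.
have closed x a : x \in scc s -> pos s v <= pos s x -> a < m ->
    done (close s v) (succ x a).
  move=> xS lvx lta; have /andP[lenx _] := fin x xS lvx.
  have [[dw _]|[wS ok]] := Iedge x a xS lta (leq_trans lta lenx).
    by rewrite Ed dw.
  (* An edge to below [v] would be recorded by a grey vertex between [v] and [x]. Only [v]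
     qualifies, and [pos s v <= low s v] excludes it. *)
  rewrite Ed wS /= leqNgt; case: ltnP; rewrite ?orbT // => ltw.
  have [_ /(_ lvx ltw)[g' gg' [l1 _ l3]]] := ok v vg.
  have Eg' : g' = v.
    move: gg'; rewrite Eg inE => /predU1P[//|/(grey_top I Eg)].
    by rewrite ltnNge l1.
  by move: l3; rewrite Eg' => l3; rewrite ltnNge (leq_trans lowv l3) in ltw.
have subS x : x \in scc (close s v) -> x \in scc s by rewrite memS => /andP[].
split=> /=.
- exact: take_uniq.
- by move=> x; rewrite -[x \in _]/(x \in scc (close s v)) => /subS; apply: Iv.
- by move=> x /ID dx; rewrite Ed dx.
- move=> x a; rewrite Ed => /orP[dx|/andP[xS lvx]] lta; last exact: closed.
  by rewrite Ed Ic.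
- move=> x; rewrite Ed => /orP[dx|/andP[xS lvx] _]; first exact: Ie.
  (* The flag gives a successor that was already finished; finished vertices are closed under edges,
     so no path leads back to [x], unfinished in [s]. *)
  have /andP[_ /(Ifl _ xS)[a lta da]] := fin x xS lvx.
  exists a => //; apply/negP=> /connectP[p].
  have : done s x = false by rewrite /done xS andbF.
  elim: p (succ x a) da => [|z p IHp] y dy ndx /=.
    by move=> _ Ex; rewrite Ex dy in ndx.
  by case/andP=> /existsP[b /eqP->]; apply: IHp => //; apply: Ic.
- move=> x a; rewrite -[x \in _]/(x \in scc (close s v)) => xS' lta ltn.
  have xS := subS _ xS'; rewrite -[_ \in take _ _]/(succ x a \in scc (close s v)).
  have [[dw fx]|[wS ok]] := Iedge _ _ xS lta ltn; first by left; rewrite Ed dw.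
  have wS' : succ x a \in scc (close s v).
    rewrite memS wS; apply: (ok v vg).1; by move: xS'; rewrite memS => /andP[].
  right; split=> // h hg; have hg' : h \in grey s.
    by move: hg; rewrite /= Eg inE => ->; rewrite orbT.
  have inS' y : y \in g -> y \in scc (close s v).
    by move=> yg; rewrite memS (grey_scc I) ?(grey_top I Eg) // Eg inE yg orbT.
  rewrite /= Eg /= in hg; rewrite !Ep ?(inS' h) //; have [ok1 ok2] := ok h hg'.
  split=> // lhx lwh; have [h' hg2 [l1 l2 l3]] := ok2 lhx lwh.
  (* The recording vertex lies at or below [x], hence below [v], and stays grey. *)
  have h'g : h' \in g.
    move: hg2; rewrite Eg inE => /predU1P[Eh|//].
    move: l2 xS'; rewrite Eh memS => l2 /andP[_]; by rewrite ltnNge l2.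
  by exists h'; rewrite /= ?Eg // !Ep ?inS'.
- move=> x; rewrite -[x \in _]/(x \in scc (close s v)) => xS' /(Ifl _ (subS _ xS'))[a lta da].
  by exists a; rewrite // Ed da.
- move=> x; rewrite -[x \in _]/(x \in scc (close s v)) => xS' xg; apply: Ifin (subS _ xS') _.
  rewrite Eg inE negb_or; move: xg; rewrite Eg /= => ->; rewrite andbT.
  by apply: contraTneq xS' => ->; rewrite memS ltnn andbF.
- rewrite size_take -/(pos _ _).
  have -> : (if pos s v < size (scc s) then pos s v else size (scc s)) = pos s v.
    by rewrite /pos index_mem vS.
  move: Ist; rewrite Eg => -[_ _ _]; apply: stack_ok_eq => [y|y yS ylt].
    rewrite memS; case: (boolP (y \in scc (close s v))) => yS'.
      by rewrite Ep // -andbA andbb.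
    by move: yS'; rewrite memS => /negbTE->.
  by rewrite Ep // memS yS.
- move=> h hg; rewrite Eg /= in hg.
  have hg' : h \in grey s by rewrite Eg inE hg orbT.
  have [l1 [w [wS Ew hw]]] := Il h hg'.
  have hS' : h \in scc (close s v) by rewrite memS (grey_scc I) ?(grey_top I Eg).
  have wS' : w \in scc (close s v).
    by rewrite memS wS Ew; apply: leq_ltn_trans l1 (grey_top I Eg hg).
  by rewrite Ep //; split=> //; exists w; split=> //; rewrite Ep.
- exact: Iw.
Qed.

Lemma grey_parent s v g : inv s -> grey s = v :: g -> low s v < pos s v ->
  exists u g', g = u :: g'.
Proof.
move=> I Eg lowv.
have vg : v \in grey s by rewrite Eg mem_head.
have [_ [w [wS Ew vw]]] := inv_low I vg.
have := inv_stack I; rewrite Eg; case: g {Eg vg} => [|u g'] [_ _ _ /=].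
  by move=> /(_ w wS); rewrite Ew => /(_ lowv).
by exists u, g'.
Qed.

(** Everything stacked reaches [v]. As [low s v < pos s v], [v] reaches a vertex below itself, which
    reaches [u]; so the whole stack still reaches the new top of the path, although [v] stays on the
    component stack. *)
Lemma retreat_inv s v u g : inv s -> grey s = [:: v, u & g] -> m <= nxt s v ->
  flag s v -> low s v < pos s v -> inv (retreat s v u).
Proof.
move=> I Eg lem flv lowv; have [U Iv ID Ic Ie Iedge Ifl Ifin Ist Il Iw] := I.
have vg : v \in grey s by rewrite Eg mem_head.
have ug : u \in grey s by rewrite Eg !inE eqxx orbT.
have uS := grey_scc I ug.
have [_ [w [wS Ew vw]]] := Il v vg.
have [stv [ste reu okg]] : (forall y, y \in scc s -> reaches y v) /\
  [/\ pos s u < pos s v, 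
    (forall y, y \in scc s -> pos s y < pos s v -> reaches y u) &
    stack_ok s (pos s u) g].
  move: Ist; rewrite Eg => -[_ _ H [_ ltu H2 okg]]; split=> // y yS.
  by apply: H => //; rewrite /pos index_mem.
have lowle y : update (low s) u (minn (low s u) (low s v)) y <= low s y.
  by rewrite /update; case: eqP => // ->; rewrite geq_minl.
have gsub x : x \in u :: g -> x \in grey s by rewrite Eg [in X in _ -> X]inE => ->; rewrite orbT.
split=> //=; rewrite ?Eg /=.
- move=> x a xS lta ltn.
  have [?|[wS' ok]] := Iedge _ _ xS lta ltn; first by left.
  right; split=> // h; rewrite {1}/retreat /= Eg /= => hg.
  have [ok1 ok2] := ok h (gsub _ hg); split=> // lhx lwh.
  have [h' + [l1 l2 l3]] := ok2 lhx lwh.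
  rewrite /= Eg /= inE => /predU1P[Eh|h'g]; last first.
    by exists h' => //; split=> //; apply: leq_trans (lowle _) l3.
  (* What [v] recorded is now recorded by [u], whose [low] absorbs that of [v]; [u] is the topmost
     remaining grey vertex, hence at or above [h]. *)
  exists u; first exact: mem_head.
  rewrite Eh in l2 l3; split.
  - move: hg; rewrite inE => /predU1P[->//|hg].
    by have /andP[_ /ltnW] := stack_ok_sub okg hg.
  - exact: leq_trans (ltnW ste) l2.
  by rewrite /= /update eqxx; apply: leq_trans (geq_minr _ _) l3.
- move=> x xS xg; case: (eqVneq x v) => [->|nxv]; first by rewrite lem.
  by apply: Ifin => //; rewrite Eg inE negb_or nxv.
- split=> //; first by rewrite /pos index_mem.
    move=> y yS _; apply: connect_trans (stv y yS) (connect_trans vw _).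
    by apply: reu => //; rewrite Ew.
  exact: stack_ok_eq okg.
- move=> h hg; have [l1 l2] := Il h (gsub _ hg).
  split; first exact: leq_trans (lowle h) l1.
  rewrite /update; case: eqP => [Eh|//]; rewrite Eh in l2 *.
  rewrite /minn; case: ifP => _; first exact: l2.
  by exists w; split=> //; apply: connect_trans (stv u uS) vw.
Qed.

(** Without a flag every edge of [v] stays on the component stack, all of whose vertices reach [v].
    The search can stop here, before the component is complete. *)
Lemma trapped_vertex s v g : inv s -> grey s = v :: g -> m <= nxt s v ->
  ~~ flag s v -> ~~ D v /\ forall a, a < m -> reaches (succ v a) v.
Proof.
move=> I Eg lem nfl.
have vS : v \in scc s by rewrite (grey_scc I) // Eg mem_head.
split=> [|a lta]; first by apply/negP=> /(inv_D I); rewrite /done vS andbF.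
have [[_ fl]|[wS _]] := inv_edge I vS lta (leq_trans lta lem).
  by rewrite fl in nfl.
by have := inv_stack I; rewrite Eg => -[_ _ H _]; apply: H; rewrite // /pos index_mem.
Qed.

Lemma all_escape s x : inv s -> grey s = [::] -> vis s x -> ~~ D x -> escapes x.
Proof.
move=> I Eg visx; apply: (inv_esc I); rewrite /done visx.
by apply/negP=> xS; have := inv_stack I; rewrite Eg => /(_ x xS)[]; rewrite /pos index_mem.
Qed.

Definition start := State [::] [::] D (fun=> 0) (fun=> 0) (fun=> false).

Lemma start_inv : (forall x a, D x -> a < m -> D (succ x a)) -> inv start.
Proof.
move=> cD; split=> //=.
- by move=> x Dx; rewrite /done /= Dx.
- by move=> x a; rewrite /done /= !andbT; apply: cD.
- by move=> x; rewrite /done /= andbT => ->.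
Qed.

(** One term per kind of step: [advance] lowers the first, [visit] the second, and both pops the
    third, which white vertices already carry. *)
Definition work s := \sum_x ((m - nxt s x) + ~~ vis s x + (~~ vis s x || (x \in grey s))).

Lemma work_lt s s' v :
  (forall x, (m - nxt s' x) + ~~ vis s' x + (~~ vis s' x || (x \in grey s')) <=
    (m - nxt s x) + ~~ vis s x + (~~ vis s x || (x \in grey s))) ->
  (m - nxt s' v) + ~~ vis s' v + (~~ vis s' v || (v \in grey s')) <
    (m - nxt s v) + ~~ vis s v + (~~ vis s v || (v \in grey s)) ->
  work s' < work s.
Proof.
move=> le lt; rewrite /work (bigD1 v) //= [X in _ < X](bigD1 v) //=.
by rewrite -addSn leq_add // leq_sum.
Qed.

Lemma visit_work s x : ~~ vis s x -> work (visit s x) < work s.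
Proof.
move=> whx; apply: (work_lt (v := x)) => [y|] /=; last first.
  by rewrite /update eqxx whx mem_head !addn1 addn0.
rewrite /update inE; case: (eqVneq y x) => [->|_] //=.
by rewrite whx addn0 leq_add2r leq_addr.
Qed.

Lemma advance_work s v : nxt s v < m -> work (advance s v) < work s.
Proof.
move=> ltm; apply: (work_lt (v := v)) => [y|].
  rewrite /advance; case: ifP => _ /=; rewrite !leq_add2r /update;
  by case: eqP => // ->; rewrite leq_sub2l.
by rewrite /advance; case: ifP => _ /=; rewrite !ltn_add2r /update eqxx;
  rewrite ltn_sub2l.
Qed.

Lemma pop_work s s' v g : inv s -> grey s = v :: g -> grey s' = g ->
  nxt s' = nxt s -> vis s' = vis s -> work s' < work s.
Proof.
move=> I Eg Eg' En Ev.
have vg : v \notin g.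
  by have /stack_uniq := inv_stack I; rewrite Eg => /andP[].
have visv : vis s v by rewrite (inv_vis I) // (grey_scc I) // Eg mem_head.
apply: (work_lt (v := v)) => [y|]; rewrite En Ev Eg Eg'.
  by rewrite leq_add2l inE; case: (vis s y) => //=; case: (y \in g); rewrite ?orbT.
by rewrite mem_head (negPf vg) visv /= !addn0 addn1.
Qed.

End DFS.

(** * Structured programs *)

Inductive cmd :=
  | Op of instr
  | Seq of cmd & cmd
  | Ifz of nat & cmd & cmd
  | While of nat & cmd.

Notation "c1 ;; c2" := (Seq c1 c2)
  (at level 60, right associativity, format "c1  ;;  c2").

Fixpoint code_size c :=
  match c with
  | Op _ => 1
  | c1 ;; c2 => code_size c1 + code_size c2
  | Ifz _ c1 c2 => code_size c1 + code_size c2 + 2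
  | While _ c1 => code_size c1 + 2
  end.

(** Jumps are absolute, hence the start address [l]. The nonzero branch comes first, since [JumpZ]
    falls through to it. *)
Fixpoint compile l c : program :=
  match c with
  | Op i => [:: i]
  | c1 ;; c2 => compile l c1 ++ compile (l + code_size c1) c2
  | Ifz r c1 c2 =>
      let l1 := l.+1 + code_size c2 in
      JumpZ r l1.+1 :: compile l.+1 c2 ++
      Jump (l1.+1 + code_size c1) :: compile l1.+1 c1
  | While r c1 =>
      JumpZ r (l.+1 + code_size c1).+1 :: compile l.+1 c1 ++ [:: Jump l]
  end.

Lemma size_compile l c : size (compile l c) = code_size c.
Proof.
elim: c l => //= [c1 IH1 c2 IH2|r c1 IH1 c2 IH2|r c1 IH1] l.
- by rewrite size_cat IH1 IH2.
- by rewrite size_cat /= IH1 IH2; lia.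
- by rewrite size_cat /= IH1; lia.
Qed.

Definition plain i :=
  match i with Jump _ | JumpZ _ _ | Halt => false | _ => true end.

Definition store : Type := (nat -> nat) * (nat -> nat).

Definition op_store i (s : store) : store :=
  let c := step [:: i] (Config 0 s.1 s.2) in (regs c, Defs.mem c).

Inductive runs : cmd -> store -> nat -> store -> Prop :=
  | RunsOp i s : plain i -> runs (Op i) s 1 (op_store i s)
  | RunsSeq c1 c2 s1 s2 s3 t1 t2 : runs c1 s1 t1 s2 -> runs c2 s2 t2 s3 ->
      runs (c1 ;; c2) s1 (t1 + t2) s3
  | RunsIfz0 r c1 c2 s s' t : s.1 r = 0 -> runs c1 s t s' ->
      runs (Ifz r c1 c2) s t.+1 s'
  | RunsIfzS r c1 c2 s s' t : s.1 r <> 0 -> runs c2 s t s' ->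
      runs (Ifz r c1 c2) s t.+2 s'
  | RunsWhile0 r c s : s.1 r = 0 -> runs (While r c) s 1 s
  | RunsWhileS r c s1 s2 s3 t1 t2 : s1.1 r <> 0 -> runs c s1 t1 s2 ->
      runs (While r c) s2 t2 s3 -> runs (While r c) s1 (t1 + t2).+2 s3.

Definition code_at (P : program) l (code : program) :=
  exists pre post, P = pre ++ code ++ post /\ l = size pre.

Lemma code_at_cat P l code1 code2 : code_at P l (code1 ++ code2) ->
  code_at P l code1 /\ code_at P (l + size code1) code2.
Proof.
move=> [pre [post [-> ->]]]; split.
  by exists pre, (code2 ++ post); rewrite !catA.
by exists (pre ++ code1), post; rewrite size_cat !catA.
Qed.

Lemma code_at_cons P l i code : code_at P l (i :: code) ->
  nth Halt P l = i /\ code_at P l.+1 code.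
Proof.
rewrite -cat1s => /code_at_cat[[pre [post [-> ->]]]]; rewrite addn1; split=> //.
by rewrite nth_cat ltnn subnn.
Qed.

Definition at_line l (s : store) := Config l s.1 s.2.
Arguments at_line : simpl never.

Lemma step_plain P l i s : plain i -> nth Halt P l = i ->
  step P (at_line l s) = at_line l.+1 (op_store i s).
Proof. by move=> pl Ei; rewrite /at_line /step /current /= Ei; case: i pl {Ei}. Qed.

Lemma compile_correct P c s t s' l : runs c s t s' ->
  code_at P l (compile l c) ->
  iter t (step P) (at_line l s) = at_line (l + code_size c) s'.
Proof.
move=> run; elim: run l => {c s t s'}.
- move=> i s pl l /code_at_cons[Ei _].
  by rewrite addn1; apply: step_plain.
- move=> c1 c2 s1 s2 s3 t1 t2 _ IH1 _ IH2 l; rewrite [compile _ _]/=.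
  move=> /code_at_cat[at1]; rewrite size_compile => at2.
  by rewrite addnC iterD IH1 // IH2 // addnA.
- move=> r c1 c2 s s' t r0 _ IH l; rewrite [compile _ _]/= => /code_at_cons[Ei].
  move=> /code_at_cat[_] /code_at_cons[_]; rewrite size_compile => at1.
  rewrite iterSr.
  have -> : step P (at_line l s) = at_line (l.+1 + code_size c2).+1 s.
    by rewrite /at_line /step /current /= Ei r0.
  by rewrite IH //; congr at_line; rewrite /=; lia.
- move=> r c1 c2 s s' t rS _ IH l; rewrite [compile _ _]/= => /code_at_cons[Ei].
  move=> /code_at_cat[at2] /code_at_cons[]; rewrite size_compile => Ej _.
  rewrite iterSr.
  have -> : step P (at_line l s) = at_line l.+1 s.
    by rewrite /at_line /step /current /= Ei; case: eqP.
  rewrite iterS IH // /at_line /step /current /= Ej.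
  by congr Config; lia.
- move=> r c s r0 l; rewrite [compile _ _]/= => /code_at_cons[Ei _].
  by rewrite iterS /at_line /step /current /= Ei r0; congr Config; lia.
- move=> r c s1 s2 s3 t1 t2 rS _ IH1 _ IH2 l at0; move: (at0).
  rewrite [compile _ _]/= => /code_at_cons[Ei] /code_at_cat[at1] /code_at_cons[].
  rewrite size_compile => Ej _; rewrite -IH2 //.
  have -> : (t1 + t2).+2 = t2 + t1.+2 by lia.
  rewrite iterD; congr iter; rewrite iterS iterSr.
  have -> : step P (at_line l s1) = at_line l.+1 s1.
    by rewrite /at_line /step /current /= Ei; case: eqP.
  by rewrite IH1 // /at_line /step /current /= Ej.
Qed.

(* Symbolic registers: unlike a function, the list stays in normal form. *)
Definition lstore : Type := seq nat * (nat -> nat).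

Definition mem_set (M : nat -> nat) (a v : nat) := fun b : nat => if b == a then v else M b.

Definition lop i (s : lstore) : lstore :=
  let: (l, M) := s in
  match i with
  | Const i k => (set_nth 0 l i k, M)
  | Move i j => (set_nth 0 l i (nth 0 l j), M)
  | Add i j k => (set_nth 0 l i (nth 0 l j + nth 0 l k), M)
  | Defs.Sub i j k => (set_nth 0 l i (nth 0 l j - nth 0 l k), M)
  | Read i j => (set_nth 0 l i (M (nth 0 l j)), M)
  | Write i j => (l, mem_set M (nth 0 l i) (nth 0 l j))
  | _ => s
  end.

Fixpoint lexec c (s : lstore) : lstore :=
  match c with
  | Op i => lop i s
  | c1 ;; c2 => lexec c2 (lexec c1 s)
  | Ifz r c1 c2 => if nth 0 s.1 r == 0 then lexec c1 s else lexec c2 s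
  | While _ _ => s
  end.

Fixpoint loop_free c :=
  match c with
  | Op i => plain i
  | c1 ;; c2 | Ifz _ c1 c2 => loop_free c1 && loop_free c2
  | While _ _ => false
  end.

Definition represents (s : store) (ls : lstore) := s.1 =1 nth 0 ls.1 /\ s.2 = ls.2.

Lemma represents_op i s ls : plain i -> represents s ls ->
  represents (op_store i s) (lop i ls).
Proof.
case: s ls => R M [l M'] pl [/= ER ->].
case: i pl => //= [i k|i j|i j k|i j k|i j|i j] _; split=> //=; rewrite ?ER // => x;
by rewrite nth_set_nth /=; case: eqP.
Qed.

(** Without loops no jump goes backwards, so each instruction is executed at most once. *)
Lemma lexec_runs c s ls : loop_free c -> represents s ls ->
  exists t s', [/\ runs c s t s', t <= code_size c & represents s' (lexec c ls)].
Proof.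
elim: c s ls => //= [i|c1 IH1 c2 IH2|r c1 IH1 c2 IH2] s ls.
- move=> pl rep; exists 1, (op_store i s).
  by split=> //; [apply: RunsOp | apply: represents_op].
- case/andP=> lf1 lf2 /(IH1 _ _ lf1)[t1 [s1 [run1 le1]]].
  case/(IH2 _ _ lf2)=> [t2 [s2 [run2 le2 rep]]].
  by exists (t1 + t2), s2; split; [apply: RunsSeq run1 run2 | rewrite leq_add |].
- case/andP=> lf1 lf2 rep; have [ER _] := rep; rewrite -ER; case: eqP => r0.
    have [t [s' [run le rep']]] := IH1 _ _ lf1 rep.
    by exists t.+1, s'; split; [apply: RunsIfz0 | lia |].
  have [t [s' [run le rep']]] := IH2 _ _ lf2 rep.
  by exists t.+2, s'; split; [apply: RunsIfzS | lia |].
Qed.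

(** * Total correctness with time bounds *)

Definition within c ls T (post : lstore -> Prop) :=
  forall s, represents s ls -> exists t s' ls',
    [/\ runs c s t s', t <= T, represents s' ls' & post ls'].

Lemma within_weaken c ls T T' (post post' : lstore -> Prop) : T <= T' ->
  (forall ls', post ls' -> post' ls') -> within c ls T post -> within c ls T' post'.
Proof.
move=> leT sub w s /w[t [s' [ls' [run le rep p]]]]; exists t, s', ls'.
by split=> //; [apply: leq_trans leT | apply: sub].
Qed.

Lemma within_loop_free c ls (post : lstore -> Prop) : loop_free c ->
  post (lexec c ls) -> within c ls (code_size c) post.
Proof.
move=> lf p s /(lexec_runs lf)[t [s' [run le rep]]].
by exists t, s', (lexec c ls).
Qed.

Lemma within_seq c1 c2 ls T1 T2 mid post : within c1 ls T1 mid ->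
  (forall ls', mid ls' -> within c2 ls' T2 post) ->
  within (c1 ;; c2) ls (T1 + T2) post.
Proof.
move=> w1 w2 s /w1[t1 [s1 [ls1 [run1 le1 rep1 /w2/(_ _ rep1)]]]].
case=> [t2 [s2 [ls2 [run2 le2 rep2 p]]]]; exists (t1 + t2), s2, ls2.
by split; [apply: RunsSeq run1 run2 | rewrite leq_add | |].
Qed.

(** [k] is a variant. An iteration costs the body, the test and the jump back; the last 1 is the
    exit test. *)
Lemma within_while r c (J : nat -> lstore -> Prop) k ls :
  loop_free c ->
  (forall k ls, J k ls -> nth 0 ls.1 r != 0 ->
    exists2 k', k' < k & J k' (lexec c ls)) ->
  J k ls ->
  within (While r c) ls (k * (code_size c + 2) + 1)
    (fun ls' => (exists k', J k' ls') /\ nth 0 ls'.1 r = 0).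
Proof.
move=> lf body; have [N leN] := ubnP k; elim: N => // N IHN in k ls leN *.
move=> Jk s rep; have [ER _] := rep; case: (eqVneq (nth 0 ls.1 r) 0) => r0.
  exists 1, s, ls; split=> //; [by apply: RunsWhile0; rewrite ER|lia|].
  by split=> //; exists k.
have [k' ltk Jk'] := body _ _ Jk r0.
have [t1 [s1 [run1 le1 rep1]]] := lexec_runs lf rep.
have [|t2 [s2 [ls2 [run2 le2 rep2 p]]]] := IHN k' _ _ Jk' s1 rep1; first by lia.
exists (t1 + t2).+2, s2, ls2; split=> //.
  by apply: RunsWhileS run1 run2; rewrite ER; apply/eqP.
have : k'.+1 * (code_size c + 2) <= k * (code_size c + 2) by rewrite leq_mul2r ltk orbT.
by rewrite mulSn; lia.
Qed.

Lemma outputs_within_compile c input T out :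
  within c ([::], nth 0 input) T (fun ls => nth 0 ls.1 0 = out) ->
  outputs_within (compile 0 c) input T out.
Proof.
case/(_ (fun=> 0, nth 0 input)); first by split=> //= x; rewrite nth_nil.
move=> t [s' [ls' [run le [ER _] Eout]]]; exists t.
have -> : init input = at_line 0 (fun=> 0, nth 0 input) by [].
rewrite /= (compile_correct run); last by exists [::], [::]; rewrite cats0.
split=> //=; last by rewrite ER.
(* The run ends just past the code, where the default instruction is [Halt]. *)
by rewrite /halted /current /= add0n -(size_compile 0 c) nth_default.
Qed.

(** * The program *)

(* Addresses beyond the input are grouped in records of 16 cells; [ld] and [st]
   access the cell [f] of the record at the address in register [a].  Vertices
   and stack positions are both represented by record addresses, so that no
   multiplication is needed.  Register 19 is scratch space. *)
Definition ld d a f := Op (Const 19 f) ;; Op (Add 19 a 19) ;; Op (Read d 19).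
Definition st a f r := Op (Const 19 f) ;; Op (Add 19 a 19) ;; Op (Write 19 r).
Definition incr r k := Op (Const 19 k) ;; Op (Add r r 19).
Definition decr d r k := Op (Const 19 k) ;; Op (Defs.Sub d r 19).
Definition mul16 r :=
  Op (Add r r r) ;; Op (Add r r r) ;; Op (Add r r r) ;; Op (Add r r r).
Definition skip := Op (Move 11 11).

(** Registers in the search: 0 answer; 1, 2 sizes; 3 first record; 4 loop condition; 5, 6 current
    root and end of roots; 7, 8 first free places of the path and of the component stack; 12 target;
    13 current vertex; 14 its next edge; 11 and 15 to 17 temporaries. *)
Definition visit_cmd :=
  Op (Const 11 1) ;; st 12 0 11 ;; st 12 6 8 ;; st 12 2 8 ;; st 8 7 12 ;;
  st 7 8 12 ;; incr 7 16 ;; incr 8 16.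

Definition root_cmd :=
  Op (Defs.Sub 11 6 5) ;;
  Ifz 11 (Op (Const 0 1) ;; Op (Const 4 0))
    (ld 11 5 0 ;; Ifz 11 (Op (Move 12 5) ;; visit_cmd) (incr 5 16)).

Definition retreat_cmd :=
  decr 13 7 16 ;; ld 13 13 8 ;; ld 17 13 2 ;; Op (Defs.Sub 11 17 15) ;;
  Ifz 11 skip (st 13 2 15).

(** The truncated difference vanishes iff the position is at most [low]; moving register 8 there
    drops the component. Stopping on a missing flag leaves the answer 0, which encodes Bob. *)
Definition finish_cmd :=
  ld 11 13 3 ;;
  Ifz 11 (Op (Const 4 0))
    (ld 15 13 2 ;; ld 16 13 6 ;; decr 7 7 16 ;; Op (Defs.Sub 11 16 15) ;;
     Ifz 11 (Op (Move 8 16)) retreat_cmd).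

(** Both rows are read at the same letter. Field 9 of the record numbered by the first image gives
    [ptr (i * n)], to which 16 times the second image is added. *)
Definition target_cmd :=
  ld 15 13 4 ;; Op (Add 15 15 14) ;; Op (Read 15 15) ;;
  ld 16 13 5 ;; Op (Add 16 16 14) ;; Op (Read 16 16) ;;
  mul16 15 ;; Op (Add 15 3 15) ;; ld 15 15 9 ;;
  mul16 16 ;; Op (Add 12 15 16).

Definition mark_cmd := Op (Const 11 1) ;; st 13 3 11.

Definition lower_cmd :=
  ld 17 13 2 ;; Op (Defs.Sub 11 17 15) ;; Ifz 11 skip (st 13 2 15).

(* The first two tests decide membership in the component stack: the recorded
   position must be below the stack pointer and hold the vertex itself. *)
Definition advance_cmd :=
  incr 14 1 ;; st 13 1 14 ;; ld 15 12 6 ;; Op (Defs.Sub 11 8 15) ;;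
  Ifz 11 mark_cmd
    (ld 16 15 7 ;; Op (Defs.Sub 11 16 12) ;; Op (Defs.Sub 17 12 16) ;;
     Op (Add 11 11 17) ;; Ifz 11 lower_cmd mark_cmd).

Definition main_cmd :=
  Op (Defs.Sub 11 7 3) ;;
  Ifz 11 root_cmd
    (decr 13 7 16 ;; ld 13 13 8 ;; ld 14 13 1 ;; Op (Defs.Sub 11 2 14) ;;
     Ifz 11 finish_cmd
       (target_cmd ;; ld 11 12 0 ;; Ifz 11 visit_cmd advance_cmd)).

(** Writing register 19 pads the symbolic register list to twenty entries, so that later stores have
    a fixed shape. Register 11 is still 0 at the first [Read]. *)
Definition header_cmd := Op (Const 19 0) ;; Op (Read 1 11) ;; Op (Const 11 1) ;;
  Op (Read 2 11) ;; Op (Const 3 2) ;; Op (Move 12 1).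

(** Adding [m] to 2 in each of [n] rounds gives the first address past the input without a
    multiplication. *)
Definition base_cmd := Op (Add 3 3 2) ;; decr 12 12 1.

Definition before_fill_cmd := Op (Move 5 3) ;; Op (Const 15 2) ;;
  Op (Const 16 2) ;; Op (Move 17 3) ;; Op (Move 18 1).

Definition next_cmd := incr 5 16 ;; incr 14 1 ;; Op (Add 16 16 2) ;;
  Op (Defs.Sub 11 1 14) ;;
  Ifz 11 (Op (Const 14 0) ;; Op (Const 16 2) ;; incr 13 1 ;; Op (Add 15 15 2) ;;
          incr 17 16 ;; decr 18 18 1) skip.

(** Diagonal pairs start as visited. They never get a stack position, so field 6 is preset to
    [ptr 0], a valid pointer for the membership test. *)
Definition fill_cmd := st 5 4 15 ;; st 5 5 16 ;; st 5 6 3 ;;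
  Ifz 14 (st 17 9 5) skip ;;
  Op (Defs.Sub 11 13 14) ;; Op (Defs.Sub 12 14 13) ;; Op (Add 11 11 12) ;;
  Ifz 11 (Op (Const 11 1) ;; st 5 0 11) skip ;; next_cmd.

Definition before_main_cmd := Op (Move 6 5) ;; Op (Move 5 3) ;; Op (Move 7 3) ;;
  Op (Move 8 3) ;; Op (Const 4 1).

Definition solver := header_cmd ;; While 12 base_cmd ;; before_fill_cmd ;;
  While 18 fill_cmd ;; before_main_cmd ;; While 4 main_cmd.

Lemma lexec_seq c1 c2 l M : lexec (c1 ;; c2) (l, M) = lexec c2 (lexec c1 (l, M)).
Proof. by []. Qed.

Lemma lexec_op i l M : lexec (Op i) (l, M) = lop i (l, M).
Proof. by []. Qed.

Lemma lexec_ifz r c1 c2 l M : lexec (Ifz r c1 c2) (l, M) =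
  if nth 0 l r == 0 then lexec c1 (l, M) else lexec c2 (l, M).
Proof. by []. Qed.

(** Four symbolic doublings would produce sixteen copies of the value; this rule keeps one
    product. *)
Lemma lexec_mul16 r l M :
  lexec (mul16 r) (l, M) = (set_nth 0 l r (16 * nth 0 l r), M).
Proof.
have double y : lexec (Op (Add r r r)) (set_nth 0 l r y, M) =
    (set_nth 0 l r (y + y), M).
  by rewrite lexec_op /lop nth_set_nth /= eqxx set_set_nth eqxx.
set x := nth 0 l r.
have -> : lexec (mul16 r) (l, M) = lexec (Op (Add r r r)) (lexec (Op (Add r r r))
  (lexec (Op (Add r r r)) (set_nth 0 l r (x + x), M))) by [].
by rewrite !double; congr (set_nth _ _ _ _, _); lia.
Qed.

Arguments lexec : simpl never.

Definition field := nat -> nat -> nat.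

(** The field is compared first: it is a numeral in the program, so writes to other fields vanish by
    computation. *)
Definition set_field (F : field) x f v : field :=
  fun x' f' => if f' == f then (if x' == x then v else F x' f') else F x' f'.

(** * Memory as an array of records *)

Section Layout.
Variables (base : nat) (input : nat -> nat).

Definition ptr k := base + 16 * k.

Definition holds M (F : field) :=
  (forall a, a < base -> M a = input a) /\
  (forall k f, f < 16 -> M (ptr k + f) = F k f).

Lemma holds_get M F k f : holds M F -> f < 16 -> M (ptr k + f) = F k f.
Proof. by case=> _; apply. Qed.

Lemma holds_set M F k f v : holds M F -> f < 16 ->
  holds (mem_set M (ptr k + f) v) (set_field F k f v).
Proof.
move=> [H1 H2] ltf; split=> [a lta|k' f' ltf']; rewrite /mem_set.
  by rewrite /ptr ltn_eqF ?H1 // -addnA (leq_trans lta) // leq_addr.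
have -> : (ptr k' + f' == ptr k + f) = (f' == f) && (k' == k).
  by rewrite /ptr; lia.
by rewrite /set_field -(H2 k' f' ltf'); case: (f' == f); case: (k' == k).
Qed.

Lemma ptrS k : ptr k + 16 = ptr k.+1.
Proof. by rewrite /ptr mulnS; lia. Qed.
Lemma ptrK k : ptr k.+1 - 16 = ptr k.
Proof. by rewrite -ptrS addnK. Qed.
Lemma ptr_add j k : ptr j + 16 * k = ptr (j + k).
Proof. by rewrite /ptr mulnDr addnA. Qed.
Lemma ptr_sub_eq0 j k : (ptr j - ptr k == 0) = (j <= k).
Proof. by rewrite /ptr; lia. Qed.
End Layout.

Arguments ptr : simpl never.

Ltac run_step := match goal with
  | |- context [lexec (mul16 ?r) (?l, ?M)] =>
      rewrite (lexec_mul16 r l M); cbn [nth set_nth]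
  | |- context [lexec (?c1 ;; ?c2) (?l, ?M)] => rewrite (lexec_seq c1 c2 l M)
  | |- context [lexec (Op ?i) (?l, ?M)] =>
      rewrite (lexec_op i l M); cbn [lop nth set_nth]
  | |- context [lexec ?c (?l, ?M)] => lazymatch c with
      | Ifz _ _ _ => fail
      | _ => first [progress unfold c | progress unfold ld, st, incr, decr]
      end
  end.

Ltac branch := match goal with
  | |- context [lexec (Ifz ?r ?c1 ?c2) (?l, ?M)] =>
      rewrite (lexec_ifz r c1 c2 l M); cbn [nth] end.

Ltac fetch H := match type of H with holds ?b ?inp _ ?F =>
  match goal with |- context [?M (ptr b ?k + ?f)] =>
    rewrite (@holds_get b inp M F k f H (erefl true)) end end.

(** After a write the memory is generalized to any one satisfying the updated [holds], so terms stay
    small. *)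
Ltac commit H := match type of H with holds ?b ?inp _ ?F =>
  match goal with |- context [mem_set ?M (ptr ?b ?k + ?f) ?v] =>
    let H' := fresh in
    have H' := @holds_set b inp M F k f v H (erefl true);
    clear H; rename H' into H; move: H;
    generalize (mem_set M (ptr b k + f) v); clear M; intros M H
  end end.

Ltac run H := repeat first [run_step | commit H].

(** * The program simulates the search *)

Section Simulation.
Variables (Q S : finType) (A : dfa Q S) (q0 : Q) (s0 : S).
Notation n := #|Q|.
Notation m := #|S|.
Notation V := (Q * Q)%type.

Definition letter a := nth s0 (enum S) a.
Definition succ (x : V) a : V := (A x.1 (letter a), A x.2 (letter a)).
Definition diag : pred V := fun x => x.1 == x.2.

Definition ix (q : Q) := index q (enum Q).
Definition idx (x : V) := ix x.1 * n + ix x.2.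

Definition input := nth 0 (encode_dfa A).
Definition base := 2 + n * m.
Notation ptr := (ptr base).
Notation holds := (holds base input).
Definition code x := ptr (idx x).

Lemma ix_lt q : ix q < n.
Proof. by rewrite /ix cardE index_mem mem_enum. Qed.

Lemma ix_inj : injective ix.
Proof. by move=> p q /(congr1 (nth q0 (enum Q))); rewrite !nth_index ?mem_enum. Qed.

Lemma idx_inj : injective idx.
Proof.
move=> [p q] [p' q'] E; have lt := ix_lt.
have n0 : 0 < n by apply: leq_trans (lt p).
have := congr1 (divn^~ n) E; have := congr1 (modn^~ n) E; rewrite /idx /=.
rewrite !modnMDl !modn_small // => /ix_inj->.
by rewrite !divnMDl // !divn_small // !addn0 => /ix_inj->.
Qed.

Lemma idx_eq x y : (idx x == idx y) = (x == y).
Proof. exact: inj_eq idx_inj x y. Qed.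

Lemma idx_lt x : idx x < n * n.
Proof.
have := ix_lt x.1; have := ix_lt x.2; rewrite /idx; nia.
Qed.

Lemma idx_surj r : r < n * n -> exists x, idx x = r.
Proof.
move=> lt; have n0 : 0 < n by case: n lt.
exists (nth q0 (enum Q) (r %/ n), nth q0 (enum Q) (r %% n)).
rewrite /idx /ix /= !index_uniq ?enum_uniq -?cardE ?ltn_pmod ?ltn_divLR //.
by rewrite -divn_eq.
Qed.

Lemma nth_allpairs (T1 T2 : Type) (f : T1 -> T2 -> nat) x1 x2 s t i j :
  i < size s -> j < size t ->
  nth 0 [seq f x y | x <- s, y <- t] (size t * i + j) = f (nth x1 s i) (nth x2 t j).
Proof.
elim: s i => // x s IHs [|i] lti ltj /=; rewrite nth_cat size_map.
  by rewrite muln0 ltj (nth_map x2).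
by rewrite mulnS -addnA ltnNge leq_addr /= addKn IHs.
Qed.

Lemma input_cell q a : a < m -> input (2 + m * ix q + a) = ix (A q (letter a)).
Proof.
move=> lta; rewrite /input /encode_dfa -addnA /= [m]cardE.
by rewrite (@nth_allpairs _ _ _ q s0) -?cardE ?ix_lt // nth_index ?mem_enum.
Qed.

Fixpoint stack_at (F : field) (g : seq V) : Prop :=
  if g is v :: g' then F (size g') 8 = code v /\ stack_at F g' else True.

Lemma stack_at_eq F F' g : (forall i, i < size g -> F' i 8 = F i 8) ->
  stack_at F g -> stack_at F' g.
Proof.
elim: g => //= v g IHg E [Fv Fg]; split; first by rewrite E.
by apply: IHg Fg => i lt; apply: E; apply: ltnW.
Qed.

(* Cells 0 to 6 describe the pair of that index, cells 7 and 8 are the two stacks,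
   and cell 9 of record [i] tabulates [i * n].  Cell 6 of a vertex that has left
   the component stack is stale. *)
Record sim (s : state V) (F : field) : Prop := Sim {
  sim_vis x : F (idx x) 0 = vis s x;
  sim_nxt x : F (idx x) 1 = nxt s x;
  sim_low x : x \in scc s -> F (idx x) 2 = ptr (low s x);
  sim_flag x : F (idx x) 3 = flag s x;
  sim_row1 x : F (idx x) 4 = 2 + m * ix x.1;
  sim_row2 x : F (idx x) 5 = 2 + m * ix x.2;
  sim_pos x : exists2 k, F (idx x) 6 = ptr k & x \in scc s -> k = pos s x;
  sim_scc x0 i : i < size (scc s) -> F i 7 = code (nth x0 (scc s) i);
  sim_grey : stack_at F (grey s);
  sim_tab q : F (ix q) 9 = ptr (ix q * n) }.


Notation search_inv := (inv m succ diag).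

Definition main_regs (s : state V) root l := exists js, size js = 11 /\
  l = [:: 0; n; m; ptr 0; 1; ptr root; ptr (n * n); ptr (size (grey s));
       ptr (size (scc s))] ++ js.

Definition running s root (ls : lstore) :=
  [/\ main_regs s root ls.1, search_inv s, exists2 F, holds ls.2 F & sim s F,
      root <= n * n & forall x, idx x < root -> vis s x].

Lemma visit_sim s x F : search_inv s -> ~~ vis s x -> sim s F ->
  sim (visit s x)
   (set_field (set_field (set_field (set_field (set_field F (idx x) 0 1)
     (idx x) 6 (ptr (size (scc s)))) (idx x) 2 (ptr (size (scc s))))
     (size (scc s)) 7 (code x)) (size (grey s)) 8 (code x)).
Proof.
move=> I whx [s_vis s_nxt s_low s_flag s_row1 s_row2 s_pos s_scc s_grey s_tab].
have xS : x \notin scc s by apply: contra whx; apply: (inv_vis I).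
split; rewrite /set_field /=.
- by move=> y; rewrite /update idx_eq; case: eqP.
- exact: s_nxt.
- move=> y; rewrite /update idx_eq mem_rcons inE; case: eqP => //= _; exact: s_low.
- exact: s_flag.
- exact: s_row1.
- exact: s_row2.
- move=> y; rewrite idx_eq; case: (eqVneq y x) => [->|nyx].
    exists (size (scc s)) => // _.
    by rewrite /pos /= -cats1 index_cat (negPf xS) /= eqxx addn0.
  have [k Ek posk] := s_pos y; exists k => //.
  rewrite mem_rcons inE (negPf nyx) /= => yS.
  by rewrite /pos /= -cats1 index_cat yS posk.
- move=> x0 i; rewrite size_rcons ltnS nth_rcons.
  case: (ltngtP i (size (scc s))) => // lti _; exact: s_scc.
- split; first by rewrite eqxx.
  by apply: stack_at_eq s_grey => i lti /=; rewrite ltn_eqF.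
- exact: s_tab.
Qed.

Lemma main_regsI s root l : size l = 20 ->
  take 9 l = [:: 0; n; m; ptr 0; 1; ptr root; ptr (n * n); ptr (size (grey s));
       ptr (size (scc s))] -> main_regs s root l.
Proof.
move=> Es Et; exists (drop 9 l); rewrite size_drop Es; split=> //.
by rewrite -{1}(cat_take_drop 9 l) Et.
Qed.

(** Passing a root lowers the first term, every other continuing step the second. *)
Definition unfinished (s : state V) root := (n * n - root) + work m s.

Definition verdict (ls : lstore) := nth 0 ls.1 4 = 0 /\
  (nth 0 ls.1 0 = 1 /\ (forall x, ~~ diag x -> escapes m succ x) \/
   nth 0 ls.1 0 = 0 /\ exists x, ~~ diag x /\
     forall a, a < m -> connect (sedge m succ) (succ x a) x).

Definition progresses s root ls :=
  (exists s' root', running s' root' ls /\ unfinished s' root' < unfinished s root)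
  \/ verdict ls.

Lemma visit_progresses s root x F M j9 j10 j11 j13 j14 j15 j16 j17 j18 j19 :
  search_inv s -> ~~ vis s x ->
  (if grey s is v :: _ then connect (sedge m succ) v x else True) ->
  holds M F -> sim s F -> root <= n * n -> (forall x, idx x < root -> vis s x) ->
  progresses s root (lexec visit_cmd
    ([:: 0; n; m; ptr 0; 1; ptr root; ptr (n * n); ptr (size (grey s));
       ptr (size (scc s)); j9; j10; j11; code x; j13; j14; j15; j16; j17; j18; j19], M)).
Proof.
move=> I whx topx H sF ler vr; rewrite /code; run H; left.
exists (visit s x), root; split; last by rewrite ltn_add2l visit_work.
split=> //; last by move=> y /vr vy; rewrite /= /update vy; case: eqP.
- by apply: main_regsI => //=; rewrite !ptrS size_rcons.
- exact: visit_inv.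
- by eexists; first exact: H; apply: visit_sim.
Qed.

Lemma root_progresses s root F M j9 j10 j11 j12 j13 j14 j15 j16 j17 j18 j19 :
  search_inv s -> grey s = [::] ->
  holds M F -> sim s F -> root <= n * n -> (forall x, idx x < root -> vis s x) ->
  progresses s root (lexec root_cmd
    ([:: 0; n; m; ptr 0; 1; ptr root; ptr (n * n); ptr (size (grey s));
       ptr (size (scc s)); j9; j10; j11; j12; j13; j14; j15; j16; j17; j18; j19], M)).
Proof.
move=> I Eg H sF ler vr; run H; branch.
rewrite ptr_sub_eq0; case: leqP => [gtr|ltr].
  (* All roots are scanned and nothing is grey, so every off-diagonal pair is finished and
     escapes. *)
  run H; right; split=> //; left; split=> // x.
  by apply: (all_escape I Eg); apply: vr; apply: leq_trans (idx_lt x) gtr.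
have [x Ex] := idx_surj ltr; subst root.
run H; fetch H; rewrite (sim_vis sF); branch.
case: (boolP (vis s x)) => visx /=; last first.
  do 2 run_step; apply: (visit_progresses (x := x) (F := F)) => //; by rewrite Eg.
run H; left; exists s, (idx x).+1; split; last first.
  by rewrite /unfinished ltn_add2r ltn_sub2l.
split=> //; last 2 first.
- by exists F.
- move=> y; rewrite ltnS leq_eqVlt => /predU1P[|/vr//].
  by move/idx_inj->.
by apply: main_regsI => //=; rewrite !ptrS.
Qed.


(** The program writes [low] only when it decreases; the case split reconciles this with [minn]. *)
Lemma retreat_sim s v u g F : search_inv s -> grey s = [:: v, u & g] -> sim s F ->
  sim (retreat s v u)
    (if low s v < low s u then set_field F (idx u) 2 (ptr (low s v)) else F).
Proof.
move=> I Eg [s_vis s_nxt s_low s_flag s_row1 s_row2 s_pos s_scc s_grey s_tab].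
have s_grey' : stack_at F (u :: g) by move: s_grey; rewrite Eg => -[].
rewrite /retreat; case: ltnP => cmp; split; rewrite /set_field /= ?Eg //=.
- move=> y yS; rewrite /update idx_eq; case: eqP => _; last exact: s_low.
  by congr ptr; apply/esym/minn_idPr/ltnW.
- by case: s_grey' => Fu Fg; split=> //; apply: stack_at_eq Fg.
- move=> y yS; rewrite /update; case: eqP => [->|_]; last exact: s_low.
  transitivity (ptr (low s u)); last by congr ptr; apply/esym/minn_idPl.
  by apply/s_low/(grey_scc I); rewrite Eg !inE eqxx orbT.
Qed.

Lemma finish_progresses s root v g F M j9 j10 j11 j12 j14 j15 j16 j17 j18 j19 :
  search_inv s -> grey s = v :: g -> m <= nxt s v ->
  holds M F -> sim s F -> root <= n * n -> (forall x, idx x < root -> vis s x) ->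
  progresses s root (lexec finish_cmd
    ([:: 0; n; m; ptr 0; 1; ptr root; ptr (n * n); ptr (size (grey s));
       ptr (size (scc s)); j9; j10; j11; j12; code v; j14; j15; j16; j17; j18; j19], M)).
Proof.
move=> I Eg lem H sF ler vr; rewrite /code; run H; fetch H; rewrite (sim_flag sF).
branch; case: (boolP (flag s v)) => flv /=; last first.
  run H; right; split=> //; right; split=> //; exists v.
  exact: (trapped_vertex I Eg).
have vg : v \in grey s by rewrite Eg mem_head.
have vS := grey_scc I vg; have [lev _] := inv_low I vg.
have [k Ek posk] := sim_pos sF v.
run H; fetch H; fetch H; rewrite (sim_low sF vS) Ek (posk vS); branch.
have -> : ptr (size (grey s)) - 16 = ptr (size g) by rewrite Eg ptrK.
rewrite ptr_sub_eq0; case: leqP => [gev|ltv].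
  run H; left; exists (close s v), root; split; last first.
    by rewrite ltn_add2l; apply: (pop_work I Eg); rewrite /= ?Eg.
  split=> //; first 2 last.
  - exists F => //; case: sF => s_vis s_nxt s_low s_flag s_row1 s_row2 s_pos s_scc s_grey s_tab.
    have subS x : x \in take (pos s v) (scc s) -> x \in scc s by apply: mem_take.
    split=> //=.
    + by move=> x /subS; apply: s_low.
    + move=> x; have [i Ei posi] := s_pos x; exists i => // xS.
      rewrite (posi (subS _ xS)) /pos -[in LHS](cat_take_drop (pos s v) (scc s)).
      by rewrite index_cat xS.
    + move=> x0 i; rewrite size_take; case: ifP => [_|].
        by move=> lti; rewrite nth_take //; apply/s_scc/(ltn_trans lti); rewrite index_mem.
      by rewrite /pos index_mem vS.
    + by rewrite Eg /=; move: s_grey; rewrite Eg => -[].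
  - apply: main_regsI => //=; rewrite Eg /= size_take.
    by case: ifP => //; rewrite /pos index_mem vS.
  - exact: (close_inv I Eg).
have [u [g' Eg']] := grey_parent I Eg ltv; rewrite {}Eg' in Eg *.
have uS : u \in scc s by rewrite (grey_scc I) // Eg !inE eqxx orbT.
have Eu : F (size g') 8 = code u.
  by move: (sim_grey sF); rewrite Eg => -[_ []].
run H; rewrite /= ptrK; fetch H; rewrite Eu /code; fetch H.
rewrite (sim_low sF uS); branch; rewrite ptr_sub_eq0.
have sF' := retreat_sim I Eg sF; rewrite leqNgt; move: sF'.
have fin M' F' l : holds M' F' -> sim (retreat s v u) F' ->
    main_regs (retreat s v u) root l -> progresses s root (l, M').
  move=> H' sF' regs; left; exists (retreat s v u), root; split; last first.
    by rewrite ltn_add2l; apply: (pop_work I Eg); rewrite /= ?Eg.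
  by split=> //; [apply: (retreat_inv I Eg) | exists F'].
case: (ltnP (low s v) (low s u)) => _ /= sF'; run H; apply: (fin _ _ _ H sF');
  by apply: main_regsI; rewrite //= Eg.
Qed.


Lemma advance_mark_sim s v F : succ v (nxt s v) \notin scc s -> sim s F ->
  sim (advance succ s v)
    (set_field (set_field F (idx v) 1 (nxt s v).+1) (idx v) 3 1).
Proof.
rewrite /advance => /negbTE->.
case=> s_vis s_nxt s_low s_flag s_row1 s_row2 s_pos s_scc s_grey s_tab.
split; rewrite /set_field //=.
- by move=> x; rewrite /update idx_eq; case: eqP.
- by move=> x; rewrite /update idx_eq; case: eqP.
- exact: stack_at_eq s_grey.
Qed.

Lemma advance_lower_sim s v F : v \in scc s -> succ v (nxt s v) \in scc s ->
  sim s F -> let w := succ v (nxt s v) in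
  let F' := set_field F (idx v) 1 (nxt s v).+1 in
  sim (advance succ s v)
    (if pos s w < low s v then set_field F' (idx v) 2 (ptr (pos s w)) else F').
Proof.
move=> vS wS; rewrite /advance wS.
case=> s_vis s_nxt s_low s_flag s_row1 s_row2 s_pos s_scc s_grey s_tab /=.
case: ltnP => cmp; split; rewrite /set_field //=.
- by move=> x; rewrite /update idx_eq; case: eqP.
- move=> x xS; rewrite /update idx_eq; case: eqP => _; last exact: s_low.
  by congr ptr; apply/esym/minn_idPr/ltnW.
- exact: stack_at_eq s_grey.
- by move=> x; rewrite /update idx_eq; case: eqP.
- move=> x xS; rewrite /update; case: eqP => [->|_]; last exact: s_low.
  transitivity (ptr (low s v)); last by congr ptr; apply/esym/minn_idPl.
  exact: s_low.
- exact: stack_at_eq s_grey.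
Qed.

Lemma advance_progresses s root v g F M j9 j10 j11 j15 j16 j17 j18 j19 :
  search_inv s -> grey s = v :: g -> nxt s v < m -> vis s (succ v (nxt s v)) ->
  holds M F -> sim s F -> root <= n * n -> (forall x, idx x < root -> vis s x) ->
  progresses s root (lexec advance_cmd
    ([:: 0; n; m; ptr 0; 1; ptr root; ptr (n * n); ptr (size (grey s));
       ptr (size (scc s)); j9; j10; j11; code (succ v (nxt s v)); code v; nxt s v;
       j15; j16; j17; j18; j19], M)).
Proof.
move=> I Eg ltm visw H sF ler vr; rewrite /code.
have vS : v \in scc s by rewrite (grey_scc I) // Eg mem_head.
set w := succ v (nxt s v) in visw *.
have fin M' F' l : holds M' F' -> sim (advance succ s v) F' ->
    main_regs s root l -> progresses s root (l, M').
  move=> H' sF' regs; left; exists (advance succ s v), root; split; last first.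
    by rewrite ltn_add2l advance_work.
  split=> //; [|exact: (advance_inv I Eg)|by exists F'|]; rewrite /advance;
  by case: ifP.
(* [k] is reliable only for stacked [w]; a stale one fails the range test or points to a cell
   holding another vertex. *)
have [k Ek posk] := sim_pos sF w; have s_scc := sim_scc sF w.
run H; rewrite addn1 in H *; fetch H; rewrite [set_field _ _ _ _ _ _]Ek.
branch; rewrite ptr_sub_eq0; case: leqP => [gek|ltk].
  have wS : w \notin scc s.
    by apply: contraL gek => wS; rewrite -ltnNge (posk wS) /pos index_mem.
  by run H; apply: (fin _ _ _ H (advance_mark_sim wS sF)); apply: main_regsI.
run H; fetch H; rewrite [set_field _ _ _ _ _ _]s_scc // /code; branch.
rewrite addn_eq0 !ptr_sub_eq0 -eqn_leq idx_eq; case: eqP => [Ew|neq]; last first.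
  have wS : w \notin scc s.
    by apply/negP=> wS; apply: neq; rewrite (posk wS) nth_index.
  by run H; apply: (fin _ _ _ H (advance_mark_sim wS sF)); apply: main_regsI.
have wS : w \in scc s by rewrite -Ew mem_nth.
run H; fetch H; rewrite [set_field _ _ _ _ _ _](sim_low sF vS) (posk wS); branch.
rewrite ptr_sub_eq0 leqNgt; have := advance_lower_sim vS wS sF.
rewrite /= -/w; case: ltnP => _ /= sF'; run H; apply: (fin _ _ _ H sF');
  exact: main_regsI.
Qed.

Lemma main_progresses s root ls : running s root ls ->
  progresses s root (lexec main_cmd ls).
Proof.
case: ls => l M [[js [Ejs /= ->]] I [F H sF] ler vr].
do 11 (case: js Ejs => [//|? js [Ejs]]); case: js Ejs => // _.
rewrite /cat; run H; branch; rewrite ptr_sub_eq0 leqn0.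
case: eqP => [/size0nil Eg|]; first exact: (root_progresses (F := F)).
case Eg: (grey s) => [//|v g] _; rewrite -Eg.
have [Fv _] : stack_at F (v :: g) by rewrite -Eg; apply: sim_grey sF.
run H; have -> : ptr (size (grey s)) - 16 = ptr (size g) by rewrite Eg ptrK.
fetch H; rewrite Fv /code; fetch H; rewrite (sim_nxt sF); branch.
rewrite subn_eq0; case: leqP => [gem|ltm].
  exact: (finish_progresses _ _ _ _ _ _ _ _ _ _ I Eg gem H sF ler vr).
(* The cell read lies below [base], where [holds] keeps the input intact. *)
have get (y : Q) : M (2 + m * ix y + nxt s v) = ix (A y (letter (nxt s v))).
  rewrite H.1 ?input_cell // /base [n * m]mulnC -addnA ltn_add2l.
  by apply: leq_trans (leq_mul (leqnn m) (ix_lt y)); rewrite mulnS addnC ltn_add2r.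
run H; fetch H; fetch H; rewrite (sim_row1 sF) (sim_row2 sF) !get.
rewrite ptr_add add0n; fetch H; rewrite (sim_tab sF) ptr_add.
rewrite -[ix _ * n + ix _]/(idx (succ v (nxt s v))); fetch H; rewrite (sim_vis sF).
branch; case: (boolP (vis s _)) => visw /=.
  exact: (advance_progresses (v := v) (g := g) (F := F)).
apply: (visit_progresses (x := succ v (nxt s v)) (F := F)) => //.
by rewrite Eg; apply: reaches_succ.
Qed.


(** * Initialization of the records *)

Definition table r : field := fun x f =>
  match f with
  | 0 => (x < r) && (x %/ n == x %% n) : nat
  | 4 => if x < r then 2 + m * (x %/ n) else 0
  | 5 => if x < r then 2 + m * (x %% n) else 0
  | 6 => if x < r then ptr 0 else 0
  | 9 => if x * n < r then ptr (x * n) else 0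
  | _ => 0
  end.

Lemma table_step p q F : q < n -> let r := p * n + q in F =2 table r ->
  let F3 := set_field (set_field (set_field F r 4 (2 + m * p)) r 5 (2 + m * q))
    r 6 (ptr 0) in
  let F4 := if q == 0 then set_field F3 p 9 (ptr r) else F3 in
  (if p == q then set_field F4 r 0 1 else F4) =2 table r.+1.
Proof.
move=> ltq r EF; have n0 : 0 < n by apply: leq_trans ltq.
have rp : r %/ n = p by rewrite divnMDl // divn_small ?addn0.
have rq : r %% n = q by rewrite modnMDl modn_small.
have lt x : (x < r.+1) = (x == r) || (x < r) by rewrite ltnS leq_eqVlt.
(* Field 9 of record [x] is written in iteration [x * n], the one with [p = x] and [q = 0]. *)
have eq9 x : (x * n == r) = (q == 0) && (x == p).
  apply/eqP/andP=> [Ex|[/eqP Eq /eqP->]]; last first.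
    by rewrite /r Eq addn0.
  by rewrite -rq -rp -Ex modnMl mulnK.
move=> F3 F4 x f.
have -> : (if p == q then set_field F4 r 0 1 else F4) x f =
    if (p == q) && (f == 0) && (x == r) then 1 else F4 x f.
  by rewrite /set_field; case: (p == q); case: (f == 0); case: (x == r).
have -> : F4 x f = if (q == 0) && (f == 9) && (x == p) then ptr r else F3 x f.
  by rewrite /F4 /set_field; case: (q == 0); case: (f == 9); case: (x == p).
rewrite /F3 /set_field EF.
case: f => [|[|[|[|[|[|[|[|[|[|f]]]]]]]]]] /=; rewrite ?andbF ?andbT ?lt ?eq9 //.
- case: (eqVneq x r) => [->|] /=; rewrite ?andbF // rp rq ltnn andbT /=.
  by case: (p == q).
- by case: (eqVneq x r) => [->|]; rewrite ?rp.
- by case: (eqVneq x r) => [->|]; rewrite ?rq.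
- by case: (eqVneq x r).
- case: (eqVneq q 0) => // q0'; case: (eqVneq x p) => [->|] //=.
  by rewrite /r q0' addn0.
Qed.

Definition base_inv k (ls : lstore) := exists j11 j19, k <= n /\
  ls = ([:: 0; n; m; 2 + m * (n - k); 0; 0; 0; 0; 0; 0; 0; j11; k; 0; 0; 0; 0; 0; 0;
            j19], input).

(** The clause for [p = n] describes the exit, where the carry has reset [q] and exactly [n * n]
    records are filled. *)
Definition fill_inv k (ls : lstore) := exists p q j11 j12 j19 M F,
  [/\ ls = ([:: 0; n; m; ptr 0; 0; ptr (p * n + q); 0; 0; 0; 0; 0; j11; j12; p; q;
            2 + m * p; 2 + m * q; ptr p; n - p; j19], M),
    [/\ q < n, p <= n & p = n -> q = 0], holds M F, F =2 table (p * n + q) &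
    k = n * n - (p * n + q)].

Lemma base_step k ls : base_inv k ls -> nth 0 ls.1 12 != 0 ->
  exists2 k', k' < k & base_inv k' (lexec base_cmd ls).
Proof.
move=> [j11 [j19 [lek ->]]] /=; case: k lek => // k lek _; exists k => //.
do !run_step; eexists _, _; split; first exact: ltnW.
congr ([:: _, _, _, _ & _], _); first by rewrite -addnA -mulnSr subnSK.
by rewrite subn1.
Qed.

Lemma fill_step k ls : fill_inv k ls -> nth 0 ls.1 18 != 0 ->
  exists2 k', k' < k & fill_inv k' (lexec fill_cmd ls).
Proof.
move=> [p [q [j11 [j12 [j19 [M [F [-> [ltq lep pn] H EF Ek]]]]]]]] /=.
rewrite subn_eq0 -ltnNge => ltp; have T := table_step ltq EF.
set r := p * n + q in H EF Ek T *.
have ltr : r < n * n.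
  by apply: leq_trans (leq_mul ltp (leqnn n)); rewrite mulSn addnC ltn_add2l.
exists (n * n - r.+1); first by rewrite Ek ltn_sub2l.
have next M' F' l11 l12 l19 : holds M' F' -> F' =2 table r.+1 ->
  fill_inv (n * n - r.+1) (lexec next_cmd
    ([:: 0; n; m; ptr 0; 0; ptr r; 0; 0; 0; 0; 0; l11; l12; p; q;
            2 + m * p; 2 + m * q; ptr p; n - p; l19], M')).
  move=> H' EF'; do !run_step; branch; rewrite subn_eq0 addn1; case: ltnP => [ltq'|geq].
    do !run_step; exists p, q.+1; do 3 eexists; exists M', F'.
    rewrite -addnA -mulnSr ptrS addnS; split=> //.
    by split=> // E; rewrite E ltnn in ltp.
  have Eq : q.+1 = n by apply/eqP; rewrite eqn_leq ltq geq.
  have Er : p.+1 * n + 0 = r.+1 by rewrite mulSn /r -addnS Eq addn0 addnC.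
  do !run_step; exists p.+1, 0; do 3 eexists; exists M', F'.
  rewrite Er -addnA -mulnSr !ptrS muln0 !addn1 subn1 -subnS; split=> //.
  by split=> //; apply: leq_trans ltq.
move: T; run H; branch; case: (q == 0) => /= T; run H; branch;
  rewrite addn_eq0 !subn_eq0 -eqn_leq; case: (p == q) T => T; run H;
  exact: next H T.
Qed.

Lemma size_input : size (encode_dfa A) = base.
Proof. by rewrite /= size_allpairs -!cardE. Qed.

Lemma start_sim F : F =2 table (n * n) -> sim (start diag) F.
Proof.
move=> EF; have n0 : 0 < n by apply: leq_trans (ix_lt q0).
have idx_div x : idx x %/ n = ix x.1 by rewrite divnMDl // divn_small ?ix_lt ?addn0.
have idx_mod x : idx x %% n = ix x.2 by rewrite modnMDl modn_small ?ix_lt.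
split; rewrite //= => x; rewrite EF /= ?idx_lt ?idx_div ?idx_mod //=.
- by rewrite (inj_eq ix_inj).
(* The component stack is empty, so any position will do. *)
- by exists 0.
by rewrite ltn_pmul2r ?ix_lt.
Qed.


(** The successor leaves variant 0 for the state after the verdict. *)
Definition main_inv k ls := verdict ls \/
  exists s root, running s root ls /\ k = (unfinished s root).+1.

Lemma main_step k ls : main_inv k ls -> nth 0 ls.1 4 != 0 ->
  exists2 k', k' < k & main_inv k' (lexec main_cmd ls).
Proof.
case=> [[-> //]|[s [root [/main_progresses step_ok ->]]] _].
case: step_ok => [[s' [root' [run lt]]]|v]; last by exists 0 => //; left.
by exists (unfinished s' root').+1 => //; right; exists s', root'.
Qed.

(** * The total running time *)

Lemma work_start : work m (start diag) <= n * n * (m + 2).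
Proof.
rewrite -card_prod -sum_nat_const; apply: leq_sum => x _ /=.
by rewrite subn0 -addnA leq_add2l; case: (diag x).
Qed.

(** The factor [m + 3] adds one root scan per pair to its initial work of at most [m + 2]; the
    successor pays for the verdict. *)
Definition solver_time := code_size header_cmd +
  (n * (code_size base_cmd + 2) + 1 + (code_size before_fill_cmd +
  (n * n * (code_size fill_cmd + 2) + 1 + (code_size before_main_cmd +
  ((n * n * (m + 3)).+1 * (code_size main_cmd + 2) + 1))))).

Lemma holds_input : holds input (table 0).
Proof.
split=> // k f _; rewrite /input nth_default; last first.
  by rewrite size_input /ptr -addnA leq_addr.
by rewrite /table; do 10 (case: f => [|f] //).
Qed.

Lemma solver_verdict : within solver ([::], input) solver_time verdict.
Proof.
have n0 : 0 < n by apply: leq_trans (ix_lt q0).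
apply: (within_seq (mid := base_inv n)).
  apply: within_loop_free => //; do !run_step.
  by eexists _, _; rewrite subnn muln0.
move=> ls1 I1; apply: (within_seq (within_while (c := base_cmd) isT base_step I1)).
move=> _ [[k [i11 [i19 [_ ->]]]] /= k0]; subst k.
have -> : 2 + m * (n - 0) = ptr 0 by rewrite /ptr /base subn0 mulnC muln0 addn0.
apply: (within_seq (mid := fill_inv (n * n))).
  apply: within_loop_free => //; do !run_step.
  exists 0, 0; do 3 eexists; exists input, (table 0); rewrite mul0n addn0 !muln0 !subn0.
  by split=> //; apply: holds_input.
move=> ls3 I3; apply: (within_seq (within_while (c := fill_cmd) isT fill_step I3)).
move=> _ [[k [p [q [j11 [j12 [j19 [M [F [-> [_ lep pn] H EF _]]]]]]]]] /= /eqP].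
rewrite subn_eq0 => gep.
have Ep : p = n by apply/eqP; rewrite eqn_leq lep.
subst p; rewrite {q pn}(pn erefl) addn0 in EF *.
apply: (within_seq (mid := main_inv (unfinished (start diag) 0).+1)).
  apply: within_loop_free => //; do !run_step; right.
  exists (start diag), 0; split=> //; split=> //.
  - by apply: main_regsI.
  - by apply: start_inv => x a; rewrite /diag => /eqP E; rewrite /succ E /=.
  - by exists F => //; apply: start_sim.
move=> ls5 I5; apply: within_weaken (within_while (c := main_cmd) isT main_step I5).
  apply: leq_add (leq_mul _ (leqnn _)) (leqnn 1).
  by rewrite ltnS /unfinished subn0 addnC addnS mulnSr leq_add2r work_start.
(* Register 4 is 1 while the search runs, so leaving the loop means a verdict. *)
case=> l M' [[k' [v|[s [root [[regs _ _ _ _] _]]]]]] //.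
by case: regs => js [_ /= ->].
Qed.

Definition solver_constant :=
  code_size header_cmd + (code_size base_cmd + 3) + code_size before_fill_cmd +
  (code_size fill_cmd + 3) + code_size before_main_cmd +
  (5 * (code_size main_cmd + 2) + 1).

Lemma solver_time_bound : 0 < n -> 0 < m ->
  solver_time <= solver_constant * (n ^ 2 * m).
Proof.
move=> n0 m0; set X := n ^ 2 * m.
have nX : n <= X by rewrite /X -mulnn -mulnA leq_pmulr // muln_gt0 n0.
have n2X : n * n <= X by rewrite /X -mulnn leq_pmulr.
have X0 : 0 < X by apply: leq_trans nX.
(* The factor 5 is 1 + 3 + 1, for [n * n * m], three times [n * n], and the successor, using that
   both sizes are positive. *)
have kX : (n * n * (m + 3)).+1 <= 5 * X.
  have -> : n * n * (m + 3) = X + n * n * 3 by rewrite mulnDr mulnn.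
  lia.
rewrite /solver_time /solver_constant.
move: (code_size header_cmd) (code_size base_cmd) (code_size before_fill_cmd)
  (code_size fill_cmd) (code_size before_main_cmd) (code_size main_cmd).
move=> c1 c2 c3 c4 c5 c6; move: (_.+1) kX => k kX.
have const c : c <= c * X by apply: leq_pmulr.
have := const c1; have := const c3; have := const c5.
have := leq_mul nX (leqnn (c2 + 2)); have := leq_mul n2X (leqnn (c4 + 2)).
have := leq_mul kX (leqnn (c6 + 2)).
move: X X0 {nX n2X kX const} => X X0; rewrite !mulnDl !mulnDr; lia.
Qed.

(** * From the verdict to the winner of the game *)

Lemma edge_sedge : pair_edge A =2 sedge m succ.
Proof.
move=> x y; apply/existsP/existsP=> [[a /eqP->]|[i /eqP->]].
  have lta : index a (enum S) < m by rewrite cardE index_mem mem_enum.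
  by exists (Ordinal lta); rewrite /succ /letter nth_index ?mem_enum.
by exists (letter i).
Qed.

Lemma escapableP x : escapable A x <-> escapes m succ x.
Proof.
have eqc := eq_connect edge_sedge; split=> [/existsP[a]|[i _]].
  rewrite eqc => noa; exists (index a (enum S)); first by rewrite cardE index_mem mem_enum.
  by rewrite /succ /letter nth_index ?mem_enum.
by rewrite -eqc => noi; apply/existsP; exists (letter i).
Qed.

Definition winner := if [forall x, diag x || escapable A x] then Alice else Bob.

Lemma verdict_winner ls : verdict ls -> nth 0 ls.1 0 = encode_player winner.
Proof.
rewrite /winner; case=> _ [[-> esc]|[-> [x [offx trapx]]]].
  case: forallP => // -[] x; case: (boolP (diag x)) => //= offx.
  exact/escapableP/esc.
case: forallP => // /(_ x); rewrite (negPf offx) => /escapableP[a lta].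
by rewrite trapx.
Qed.

Lemma winner_wins first : has_winning_strategy A first winner.
Proof.
have Q0 : 0 < n by apply: leq_trans (ix_lt q0).
have S0 : 0 < m by apply/card_gt0P; exists s0.
rewrite /winner; case: ifP => [/forallP esc|/negbT/forallPn[x]].
  by apply: alice_wins => // x offx; have := esc x; rewrite /diag (negPf offx).
by rewrite negb_or => /andP[]; apply: bob_wins.
Qed.

Lemma solver_outputs : outputs_within (compile 0 solver) (encode_dfa A)
  (solver_constant * (n ^ 2 * m)) (encode_player winner).
Proof.
have Q0 : 0 < n by apply: leq_trans (ix_lt q0).
have S0 : 0 < m by apply/card_gt0P; exists s0.
apply: outputs_within_compile.
exact: within_weaken (solver_time_bound Q0 S0) verdict_winner solver_verdict.
Qed.

End Simulation.

Theorem theorem4p5 :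
  exists (P : program) (C : nat),
    forall (Q S : finType) (A : dfa Q S),
      3 <= #|Q| -> 0 < #|S| ->
      exists winner : player,
        (forall first : player, has_winning_strategy A first winner) /\
        outputs_within P (encode_dfa A) (C * (#|Q| ^ 2 * #|S|))
          (encode_player winner).
Proof.
exists (compile 0 solver), solver_constant => Q S A Q3 /card_gt0P[s0 _].
have /card_gt0P[q0 _] : 0 < #|Q| by apply: leq_trans Q3.
exists (winner A); split; first exact: winner_wins q0 s0.
exact: solver_outputs q0 s0.
Qed.
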